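(* Let $\lambda,\mu,\nu\in\Lambda$ and $g_1\in\mathcal{D}_{\lambda\mu}$, and suppose $B=(b_{ij})=\kappa(\lambda,g_1,\mu)$ is tridiagonal, i.e. $b_{ij}=0$ whenever $|i-j|>1$. Let \[\delta=\delta(B)=(b'_{00},b_{10};\ b_{01},b_{11},b_{21};\ \dots;\ b_{r-1,r},b_{rr},b_{r+1,r};\ b_{r,r+1},b'_{r+1,r+1})\in\Lambda_{3r+2,d}\] (components indexed $0,1,\dots,3r+3$), where $b'_{ii}=(b_{ii}-1)/2$ for $i\in\{0,r+1\}$. Then for every $g_2\in\mathcal{D}_{\mu\nu}$ and every $w\in\mathcal{D}_\delta\cap W_\mu$, in $\mathbf H$, \[ T_{g_1}T_{wg_2}=\sum_{\sigma\in K_w}(v^2-1)^{n(\sigma)}v^{2h(w,\sigma)}T_{g_1\sigma wg_2}. \]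
   Context: Fix integers $r\ge0$, $d\ge2$, $n=2r+2$, $D=2d+2$. $W$ is the group of bijections $g:\mathbb{Z}\to\mathbb{Z}$ with $g(i+D)=g(i)+D$, $g(-i)=-g(i)$, a Coxeter group of type $\widetilde C_d$ with simple reflections $s_0,\dots,s_d$ where (elements determined by their values on $1,\dots,d$) $s_0(1)=-1$, $s_0(k)=k$ ($k\ge2$); $s_d(d)=d+2$, $s_d(k)=k$ ($k<d$); $s_i$ ($1\le i\le d-1$) swaps $i,i+1$. $\ell$ is Coxeter length. For distinct $j,k$, $(j,k)_{\mathfrak c}\in W$ denotes the element swapping $tD\pm j$ with $tD\pm k$ for all $t\in\mathbb{Z}$ and fixing all other integers. $\mathbf H$ is the Hecke algebra over $\mathbb{Z}[v,v^{-1}]$ with basis $T_w$, $T_wT_{w'}=T_{ww'}$ when $\ell(ww')=\ell(w)+\ell(w')$, $(T_s+1)(T_s-v^2)=0$. For $r'\ge0$, $\Lambda_{r',d}$ is the set of $\lambda=(\lambda_0,\dots,\lambda_{r'+1})\in\mathbb{N}^{r'+2}$ with sum $d$, and $\Lambda=\Lambda_{r,d}$. For $\lambda\in\Lambda_{r',d}$, with $\lambda_{0,i}=\lambda_0+\dots+\lambda_i$: $W_\lambda$ is generated by $\{s_0,\dots,s_d\}\setminus\{s_{\lambda_{0,0}},\dots,s_{\lambda_{0,r'}}\}$; $R_0^\lambda=[-\lambda_0..\lambda_0]$, $R_i^\lambda=(\lambda_{0,i-1}..\lambda_{0,i}]$ ($1\le i\le r'$), $R^\lambda_{r'+1}=[d+1-\lambda_{r'+1}..d+1+\lambda_{r'+1}]$,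 extended by $R^\lambda_{-i}=-R^\lambda_i$, $R^\lambda_{i+2r'+2}=R^\lambda_i+D$; $\mathcal{D}_\lambda=\{g\mid \ell(wg)=\ell(w)+\ell(g)\ \forall w\in W_\lambda\}$; $\mathcal{D}_{\lambda\mu}=\mathcal{D}_\lambda\cap\mathcal{D}_\mu^{-1}$. For $\lambda,\mu\in\Lambda$, $\kappa(\lambda,g,\mu)=(|R_i^\lambda\cap g(R_j^\mu)|)_{i,j\in\mathbb{Z}}$. Given $g_2$ and $w$ as in the claim, for $1\le i\le r+1$ let $K_w^{(i)}$ be the set of all products (including the empty product $=1$) of transpositions $(j_1,k_1)_{\mathfrak c}\cdots(j_s,k_s)_{\mathfrak c}$ with $j_1,\dots,j_s\in R^\delta_{3i-2}$ pairwise distinct, $k_1,\dots,k_s\in R^\delta_{3i-1}$ pairwise distinct, and $(wg_2)^{-1}(k_l)<(wg_2)^{-1}(j_l)$ for each $l$. Let $K_w=\{\prod_{i=1}^{r+1}\sigma^{(i)}\mid\sigma^{(i)}\in K_w^{(i)}\}$; for $\sigma\in K_w$, $n(\sigma)$ is the total number of transpositions in this product, and $h(w,\sigma)=|H(w,\sigma)|$ where \[H(w,\sigma)=\bigcup_{i=1}^{r+1}\{(j,k)\in R^\delta_{3i-2}\times R^\delta_{3i-1}\mid (wg_2)^{-1}\sigma(j)>(wg_2)^{-1}(k),\ (wg_2)^{-1}(j)>(wg_2)^{-1}\sigma(k)\}.\] *)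

(* Defs.v *)
From mathcomp Require Import all_boot all_algebra.
From Stdlib Require Import ClassicalEpsilon.
Unset Printing Implicit Defensive.
Import GRing.Theory Num.Theory.
Local Open Scope ring_scope.

(* ---------- The affine Weyl group W of type C~_d, acting on Z ---------- *)

Definition DD (d : nat) : int := (2 * d + 2)%N%:Z.

Definition inW (d : nat) (g : int -> int) : Prop :=
  bijective g /\ (forall i, g (i + DD d) = g i + DD d) /\ (forall i, g (- i) = - g i).

(* The unique element of W with prescribed values f(1), ..., f(d) on 1..d
   (forced: g(tD) = tD, g(tD+d+1) = tD+d+1, g(tD - i) = tD - g(i)). *)
Definition ext (d : nat) (f : int -> int) (x : int) : int :=
  let q := (x %/ DD d)%Z in
  let k := (x %% DD d)%Z in
  if k == 0 then q * DD d
  else if k <= d%:Z then f k + q * DD d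
  else if k == d.+1%:Z then q * DD d + d.+1%:Z
  else q * DD d + DD d - f (DD d - k).

Definition swin (d j : nat) (k : int) : int :=
  if j == 0%N then (if k == 1 then -1 else k)
  else if j == d then (if k == d%:Z then d%:Z + 2 else k)
  else (if k == j%:Z then j%:Z + 1 else if k == j%:Z + 1 then j%:Z else k).

Definition sref (d j : nat) : int -> int := ext d (swin d j).

Definition wprod (d : nat) (l : seq nat) : int -> int :=
  foldr (fun j f => sref d j \o f) id l.

Definition word_ok (d : nat) (l : seq nat) : bool := all (fun j => j <= d)%N l.

Definition is_len (d : nat) (g : int -> int) (n : nat) : Prop :=
  (exists l, word_ok d l /\ size l = n /\ wprod d l =1 g) /\
  (forall l, word_ok d l -> wprod d l =1 g -> (n <= size l)%N).

Definition len_add (d : nat) (x y : int -> int) : Prop :=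
  forall a b c, is_len d x a -> is_len d y b -> is_len d (x \o y) c -> c = (a + b)%N.

Definition hecke_rel (d : nat) (R : nzRingType) (v : R) (T : (int -> int) -> R) : Prop :=
  (forall a : R, v * a = a * v) /\
  (exists u : R, u * v = 1 /\ v * u = 1) /\
  T id = 1 /\
  (forall x y, inW d x -> inW d y -> len_add d x y -> T (x \o y) = T x * T y) /\
  (forall j, (j <= d)%N -> (T (sref d j) + 1) * (T (sref d j) - v ^+ 2) = 0).

Definition inLambda (r' d : nat) (lam : seq nat) : bool :=
  (size lam == r'.+2) && (sumn lam == d).

Definition psum (lam : seq nat) (i : nat) : nat := sumn (take i.+1 lam).

Definition par_ok (r' d : nat) (lam : seq nat) (j : nat) : bool :=
  (j <= d)%N && (j \notin [seq psum lam i | i <- iota 0 r'.+1]).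

Definition inWpar (r' d : nat) (lam : seq nat) (w : int -> int) : Prop :=
  exists l, all (par_ok r' d lam) l /\ wprod d l =1 w.

Definition inDmin (r' d : nat) (lam : seq nat) (g : int -> int) : Prop :=
  inW d g /\ forall w, inWpar r' d lam w -> len_add d w g.

Definition inDmin2 (r' d : nat) (lam mu : seq nat) (g : int -> int) : Prop :=
  inDmin r' d lam g /\
  exists h, inW d h /\ cancel g h /\ cancel h g /\ inDmin r' d mu h.

Definition baseR (r' d : nat) (lam : seq nat) (k : nat) (y : int) : bool :=
  if k == 0%N then (- (nth 0%N lam 0)%:Z <= y) && (y <= (nth 0%N lam 0)%:Z)
  else if (k <= r')%N then ((psum lam k.-1)%:Z < y) && (y <= (psum lam k)%:Z)
  else (d.+1%:Z - (nth 0%N lam r'.+1)%:Z <= y) && (y <= d.+1%:Z + (nth 0%N lam r'.+1)%:Z).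

(* x \in R_i^lambda, i in Z, using R_{-i} = -R_i and R_{i+2r'+2} = R_i + D *)
Definition inR (r' d : nat) (lam : seq nat) (i x : int) : bool :=
  let m := (2 * r' + 2)%N%:Z in
  let q := (i %/ m)%Z in
  let k := (i %% m)%Z in
  let y := x - q * DD d in
  if k <= r'.+1%:Z then baseR r' d lam `|k|%N y
  else baseR r' d lam (2 * r' + 2 - `|k|)%N (DD d - y).

(* kappa(lambda, g, mu)_{ij} = |R_i^lambda \cap g(R_j^mu)|
   = #{ z in R_j^mu | g z in R_i^lambda } (g injective);
   R_j^mu is contained in q D + [-D, 2D] where q = j div (2r+2). *)
Definition kappa (r d : nat) (lam : seq nat) (g : int -> int) (mu : seq nat) (i j : int) : nat :=
  let q := (j %/ (2 * r + 2)%N%:Z)%Z in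
  count (fun z => inR r d mu j z && inR r d lam i (g z))
        [seq q * DD d + k%:Z - DD d | k <- iota 0 (3 * (2 * d + 2)).+1].

Definition tridiagonal (B : int -> int -> nat) : Prop :=
  forall i j : int, 1 < `|i - j| -> B i j = 0%N.

(* delta(B) = (b'_00, b_10; b_01, b_11, b_21; ...; b_{r,r+1}, b'_{r+1,r+1}),
   entry t = 3j-1 : b_{j-1,j};  t = 3j : b_{jj} (primed for j = 0, r+1);
   t = 3j+1 : b_{j+1,j}. *)
Definition delta_seq (r : nat) (B : int -> int -> nat) : seq nat :=
  mkseq (fun t =>
    let j := ((t + 1) %/ 3)%N in
    let c := ((t + 1) %% 3)%N in
    if c == 0%N then B (j%:Z - 1) j%:Z
    else if c == 1%N then
      (if (j == 0%N) || (j == r.+1) then ((B j%:Z j%:Z).-1 %/ 2)%N else B j%:Z j%:Z)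
    else B (j%:Z + 1) j%:Z) (3 * r + 4).

Definition trc (d : nat) (j k : int) (x : int) : int :=
  if ((x - j) %% DD d)%Z == 0 then x - j + k
  else if ((x + j) %% DD d)%Z == 0 then x + j - k
  else if ((x - k) %% DD d)%Z == 0 then x - k + j
  else if ((x + k) %% DD d)%Z == 0 then x + k - j
  else x.

Definition finv (h : int -> int) (k : int) : int :=
  epsilon (inhabits 0) (fun x => h x = k).

Definition pair_int (d : nat) (p : 'I_d.+1 * 'I_d.+1) : int * int :=
  ((nat_of_ord p.1)%:Z, (nat_of_ord p.2)%:Z).

Definition blockpair (r d : nat) (delta : seq nat) (j k : int) : bool :=
  [exists i : 'I_(r.+2), (0 < i)%N &&
     inR (3 * r + 2) d delta (3 * (nat_of_ord i)%:Z - 2) j &&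
     inR (3 * r + 2) d delta (3 * (nat_of_ord i)%:Z - 1) k].

(* A set M of pairs (j_l, k_l) describing an element of K_w:
   each pair in some R_{3i-2} x R_{3i-1}, (wg2)^{-1}(k) < (wg2)^{-1}(j),
   the j's pairwise distinct and the k's pairwise distinct. *)
Definition validK (r d : nat) (delta : seq nat) (h : int -> int)
    (M : {set 'I_d.+1 * 'I_d.+1}) : bool :=
  [forall p in M, blockpair r d delta (pair_int d p).1 (pair_int d p).2 &&
                  (finv h (pair_int d p).2 < finv h (pair_int d p).1)] &&
  [forall p in M, forall p' in M,
      ((p.1 == p'.1) ==> (p == p')) && ((p.2 == p'.2) ==> (p == p'))].

Definition sigmaK (d : nat) (M : {set 'I_d.+1 * 'I_d.+1}) : int -> int :=
  foldr (fun p f => trc d (pair_int d p).1 (pair_int d p).2 \o f) id (enum M).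

Definition hcount (r d : nat) (delta : seq nat) (h : int -> int) (sigma : int -> int) : nat :=
  #|[set p : 'I_d.+1 * 'I_d.+1 |
      blockpair r d delta (pair_int d p).1 (pair_int d p).2 &&
      (finv h (pair_int d p).2 < finv h (sigma (pair_int d p).1)) &&
      (finv h (sigma (pair_int d p).2) < finv h (pair_int d p).1)]|.

(* Main.v *)
Require Import Defs.
From mathcomp Require Import all_boot all_order all_algebra zify.
From Stdlib Require Import ClassicalEpsilon FunctionalExtensionality.
Import GRing.Theory Num.Theory Order.TTheory.
Local Open Scope ring_scope.

(** Idea. By tridiagonality and minimality, g1 preserves [1..d] and exchanges the adjacent
    blocks R^delta_(3i-2) and R^delta_(3i-1), so its inversions in [1..d] are exactly the
    pairs (j, k) of R^delta_(3i-2) x R^delta_(3i-1), while X = (w g2)^-1 increases on each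
    block.  The formula holds more generally for every g preserving [1..d] whose set F of
    inversions consists of such pairs, with matchings M and the exponent h both restricted
    to F; it is proved by induction on #|F|.  Write g = s_p g' with one new inversion (j, k)
    and multiply the formula for g' by T_(s_p).  If X(sigma j) < X(sigma k) the length grows,
    and neither h changes nor M + (j, k) is allowed.  Otherwise j and k are both unmatched in
    M, and the two terms of the quadratic relation correspond to M, for which h grows by 1,
    and to M + (j, k), for which h is that of M in g', since g' sigma_M = g sigma_(M + (j, k)). *)

(** * The group W and its reflections *)

(** Length is given only as the least size of a word and [T] only through its relations, so every
    statement about lengths has to be won from the action on the integers. The bridge is the strong
    exchange condition: s_p shortens an element exactly when its inverse descends from p to p + 1,
    for all p from 0 to d.

    The generalisation beyond [g1] is forced: after one letter is stripped from [g1], the rest need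
    not be minimal in its double coset, so minimality cannot be the induction hypothesis. What
    survives is that the inversions inside [1..d] stay in a fixed set [B] of pairs on which X is
    monotone in each coordinate, and in which no index is both a left and a right end. This last
    property does two things. It makes the transpositions of a matching disjoint, and it forces the
    new inversion (j, k) to be extreme among the pairs of F that share j or k, which settles every
    comparison in the induction step. *)

Lemma mod0P d (y : int) : reflect (exists t, y = t * DD d) ((y %% DD d)%Z == 0).
Proof.
by apply: (iffP eqP) => [/dvdz_mod0P/dvdzP//|H]; apply/dvdz_mod0P/dvdzP.
Qed.

(** Turns the congruence tests of [trc] into finitely many equations, so that [lia] can decide the
    case analyses on one period. *)
Lemma mod0_small d (y : int) : - 4%:Z * DD d < y < 4%:Z * DD d ->
  ((y %% DD d)%Z == 0) =
  [|| y == 0, y == DD d, y == - DD d, y == DD d + DD d, y == - DD d - DD d,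
      y == 3%:Z * DD d | y == - 3%:Z * DD d].
Proof.
move=> H; apply/mod0P/idP => [[t E]|C].
  have : t = 0 \/ t = 1 \/ t = -1 \/ t = 2 \/ t = -2 \/ t = 3 \/ t = -3.
    by rewrite /DD in E H; nia.
  by rewrite /DD in E H *; move=> T; repeat case: T => [T|T]; subst t; lia.
have : y = 0 * DD d \/ y = 1 * DD d \/ y = -1 * DD d \/ y = 2 * DD d \/ y = -2 * DD d
  \/ y = 3 * DD d \/ y = -3 * DD d by rewrite /DD in C *; lia.
by move=> T; repeat case: T => [->|T]; first [by eexists | rewrite T; by eexists].
Qed.

Lemma mod0_shift d (y t : int) : (((y + t * DD d) %% DD d)%Z == 0) = ((y %% DD d)%Z == 0).
Proof. by rewrite addrC modzMDl. Qed.

Lemma mod0_opp d (y : int) : (((- y) %% DD d)%Z == 0) = ((y %% DD d)%Z == 0).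
Proof.
by apply/mod0P/mod0P=> -[t E]; exists (- t); rewrite mulNr -E ?opprK.
Qed.

Definition periodic d (f : int -> int) := forall i, f (i + DD d) = f i + DD d.

Lemma periodicM d f : periodic d f -> forall t i, f (i + t * DD d) = f i + t * DD d.
Proof.
move=> P; have Pn n i : f (i + n%:Z * DD d) = f i + n%:Z * DD d.
  elim: n i => [|n IH] i; first by rewrite mul0r !addr0.
  by rewrite -addn1 PoszD mulrDl mul1r !addrA P IH.
case=> n i; first exact: Pn.
rewrite NegzE; have := Pn n.+1 (i - n.+1%:Z * DD d).
by rewrite subrK mulNr => ->; rewrite addrK.
Qed.

Lemma int_reduce d (x : int) : exists t y, x = y + t * DD d /\ 0 <= y < DD d.
Proof.
exists (x %/ DD d)%Z, (x %% DD d)%Z; split; first by rewrite addrC -divz_eq.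
by apply/andP; split; [apply: modz_ge0 | apply: ltz_pmod]; rewrite /DD; lia.
Qed.

Lemma periodic_eq d f g : periodic d f -> periodic d g ->
  (forall i, 0 <= i < DD d -> f i = g i) -> f =1 g.
Proof.
move=> Pf Pg E x; have [t [y [-> H]]] := int_reduce d x.
by rewrite (periodicM _ _ Pf) (periodicM _ _ Pg) E.
Qed.

Lemma periodic_comp d f g : periodic d f -> periodic d g -> periodic d (f \o g).
Proof. by move=> Pf Pg i; rewrite /= Pg Pf. Qed.

Lemma inW_comp d f g : inW d f -> inW d g -> inW d (f \o g).
Proof.
move=> [bf [pf of_]] [bg [pg og]]; split; first exact: bij_comp.
by split=> i /=; rewrite ?pg ?pf ?og ?of_.
Qed.

Lemma inW_id d : inW d id.
Proof. by split; first by exists id. Qed.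

Lemma inW_inv d g h : inW d g -> cancel g h -> cancel h g -> inW d h.
Proof.
move=> [bg [pg og]] gK hK; split; first by exists g.
by split=> i; apply: (can_inj gK); rewrite ?pg ?og !hK.
Qed.

Lemma inWP d g : inW d g -> exists h, [/\ cancel g h, cancel h g & inW d h].
Proof.
by move=> W; case: (W) => -[h gK hK] _; exists h; split => //; apply: inW_inv gK hK.
Qed.

Lemma inW_inj d g : inW d g -> injective g.
Proof. by case=> -[h gK _] _; apply: can_inj gK. Qed.

Lemma inW_D d g t i : inW d g -> g (i + t * DD d) = g i + t * DD d.
Proof. by case=> _ [P _]; apply: periodicM. Qed.

Lemma inW_N d g i : inW d g -> g (- i) = - g i.
Proof. by case=> _ []. Qed.

Lemma inW_0 d g : inW d g -> g 0 = 0.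
Proof. by move=> W; have := inW_N d g 0 W; rewrite oppr0; move: (g 0) => y; lia. Qed.

Lemma inW_refl d g x : inW d g -> g (DD d - x) = DD d - g x.
Proof.
by move=> W; have := inW_D d g 1 (- x) W; rewrite mul1r addrC => ->; rewrite (inW_N d) // addrC.
Qed.

Lemma inW_mid d g : inW d g -> g d.+1 = d.+1.
Proof.
move=> W; have := inW_refl d g d.+1 W.
have -> : DD d - d.+1%:Z = d.+1%:Z; first by rewrite /DD; lia.
by move: (g _) => y; rewrite /DD; lia.
Qed.

(** The centres 0 and d + 1 are fixed by all of W, and x -> D - x carries the rest of a period into
    [1..d]. *)
Lemma inW_ext d f g : inW d f -> inW d g ->
  (forall i, 1 <= i <= d%:Z -> f i = g i) -> f =1 g.
Proof.
move=> Wf Wg E; apply: (periodic_eq d); [by case: Wf => _ []|by case: Wg => _ []|].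
move=> i Hi; have [H|H] := boolP (1 <= i <= d%:Z); first exact: E.
have [->|H0] := eqVneq i 0; first by rewrite !(inW_0 d).
have [->|H1] := eqVneq i d.+1; first by rewrite !(inW_mid d).
have : f (DD d - i) = g (DD d - i) by apply: E; rewrite /DD in Hi *; lia.
rewrite (inW_refl d f) // (inW_refl d g) //.
by move: (f i) (g i) => y z; lia.
Qed.

Lemma inW_cong d g x y : inW d g -> (((g x - g y) %% DD d)%Z == 0) = (((x - y) %% DD d)%Z == 0).
Proof.
move=> W; apply/mod0P/mod0P => -[t E]; exists t.
  apply/eqP; rewrite subr_eq; apply/eqP; apply: (inW_inj d g W).
  by rewrite addrC (inW_D d) // -E addrC subrK.
have -> : x = y + t * DD d by rewrite -E addrC subrK.
by rewrite (inW_D d g) // addrC addKr.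
Qed.

Lemma inW_congN d g x y : inW d g -> (((g x + g y) %% DD d)%Z == 0) = (((x + y) %% DD d)%Z == 0).
Proof.
by move=> W; have := inW_cong d g x (- y) W; rewrite (inW_N d g) // !opprK.
Qed.

Lemma trc_periodic d j k : periodic d (trc d j k).
Proof.
move=> i; rewrite /trc.
have E c : ((i + DD d + c) %% DD d)%Z = ((i + c) %% DD d)%Z by rewrite addrAC modzDr.
rewrite !E.
by repeat case: ifP => _; lia.
Qed.

(** An element of W preserves congruence of x with y and with -y modulo D, so it carries each branch
    of [trc] to the same branch. No condition on j and k is involved, so a reflection can be moved
    through a word freely. *)
Lemma trc_conj d g j k : inW d g -> g \o trc d j k =1 trc d (g j) (g k) \o g.
Proof.
move=> W x; rewrite /= /trc !(inW_cong d g) // !(inW_congN d g) //.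
have N y : g (- y) = - g y by apply: inW_N W.
case: ifP => [/mod0P[t E]|_].
  have -> : x = j + t * DD d by rewrite -E addrC subrK.
  have -> : j + t * DD d - j + k = k + t * DD d; first by lia.
  by rewrite !(inW_D d g) //; lia.
case: ifP => [/mod0P[t E]|_].
  have -> : x = - j + t * DD d; first by lia.
  have -> : - j + t * DD d + j - k = - k + t * DD d; first by lia.
  by rewrite !(inW_D d g) // !N; lia.
case: ifP => [/mod0P[t E]|_].
  have -> : x = k + t * DD d; first by lia.
  have -> : k + t * DD d - k + j = j + t * DD d; first by lia.
  by rewrite !(inW_D d g) //; lia.
case: ifP => [/mod0P[t E]|_] //.
have -> : x = - k + t * DD d; first by lia.
have -> : - k + t * DD d + k - j = - j + t * DD d; first by lia.
by rewrite !(inW_D d g) // !N; lia.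
Qed.

Lemma trc_shift d j k t : trc d (j + t * DD d) (k + t * DD d) =1 trc d j k.
Proof.
move=> x; rewrite /trc.
have -> : x - (j + t * DD d) = (x - j) + (- t) * DD d; first by lia.
have -> : x - (k + t * DD d) = (x - k) + (- t) * DD d; first by lia.
rewrite !addrA !mod0_shift.
by repeat case: ifP => _; lia.
Qed.

(** With these ends each s_p, also s_0 and s_d, is the [trc] of an increasing pair, so the three
    kinds of generators share one treatment. For p = 0 and p = d the ends are two apart, on either
    side of the centre 0 or d + 1. *)
Definition root_l (d p : nat) : int := if p == 0%N then -1 else p%:Z.
Definition root_r (d p : nat) : int := if p == 0%N then 1 else if p == d then d%:Z + 2 else p%:Z + 1.

Ltac iflia := repeat (case: ifP => ? //=); lia.

Lemma trc_small d j k x : (2 <= d)%N -> - (DD d) < j < DD d -> - (DD d) < k < DD d ->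
  0 <= x < DD d ->
  trc d j k x =
    if [|| x == j, x == j + DD d | x == j - DD d] then x - j + k
    else if [|| x == - j, x == DD d - j | x == - DD d - j] then x + j - k
    else if [|| x == k, x == k + DD d | x == k - DD d] then x - k + j
    else if [|| x == - k, x == DD d - k | x == - DD d - k] then x + k - j else x.
Proof.
move=> hd hj hk hx; rewrite /trc !mod0_small; try (rewrite /DD in hj hk hx *; lia).
do 4 (congr (if _ then _ else _); first by rewrite /DD in hj hk hx *; lia).
Qed.

Lemma ext_periodic d f : periodic d (ext d f).
Proof.
have n0 : DD d != 0 by rewrite /DD; lia.
move=> i; rewrite /ext modzDr divzDr ?dvdzz // divzz n0.
move: (i %% DD d)%Z (i %/ DD d)%Z => m q; move: (f m) (f (DD d - m)) => y z.
by rewrite /=; repeat case: ifP => _; lia.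
Qed.

Lemma srefE d p : (2 <= d)%N -> (p <= d)%N -> sref d p =1 trc d (root_l d p) (root_r d p).
Proof.
move=> hd hp; apply: (periodic_eq d); [exact: ext_periodic|exact: trc_periodic|].
move=> x; rewrite -[x]/(x : int); move: (x : int) => {}x hx; rewrite /sref /ext divz_small; last by rewrite /DD in hx *; lia.
rewrite modz_small; last by rewrite /DD in hx *; lia.
rewrite trc_small //; try by rewrite /root_l /root_r /DD; iflia.
rewrite /swin /root_l /root_r /DD in hx *.
by have [p0|p0] := boolP (p == 0%N); last have [pd|pd] := boolP (p == d); iflia.
Qed.

Lemma sref_val d p x : (2 <= d)%N -> (p <= d)%N -> 0 <= x < DD d ->
  sref d p x = if p == 0%N then (if x == 1 then -1 else if x == DD d - 1 then DD d + 1 else x)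
    else if p == d then (if x == d%:Z then d%:Z+2 else if x == d%:Z + 2 then d%:Z else x)
    else if (x == p%:Z) || (x == DD d - p%:Z - 1) then x + 1
    else if (x == p%:Z + 1) || (x == DD d - p%:Z) then x - 1 else x.
Proof.
move=> hd hp hx; rewrite srefE // trc_small //; try by rewrite /root_l /root_r /DD; iflia.
rewrite /root_l /root_r /DD in hx *.
by have [p0|p0] := boolP (p == 0%N); last have [pd|pd] := boolP (p == d); iflia.
Qed.

Lemma sref_per d p : periodic d (sref d p).
Proof. exact: ext_periodic. Qed.

Ltac srefcases p d := have [?|?] := boolP (p == 0%N); last have [?|?] := boolP (p == d).

Lemma sref_odd d p : (2 <= d)%N -> (p <= d)%N -> forall i, sref d p (- i) = - sref d p i.
Proof.
move=> hd hp i; have [t [y [-> hy]]] := int_reduce d i.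
rewrite opprD -mulNr !(periodicM _ _ (sref_per d p)).
have [->|y0] := eqVneq y 0.
  by rewrite oppr0 !sref_val //; rewrite /DD; srefcases p d; iflia.
have -> : - y = (DD d - y) + (-1) * DD d by rewrite mulN1r addrC addrA addNr add0r.
rewrite (periodicM _ _ (sref_per d p)) !sref_val //; try by rewrite /DD in hy *; lia.
by rewrite /DD in hy *; srefcases p d; iflia.
Qed.

Lemma srefK d p : (2 <= d)%N -> (p <= d)%N -> involutive (sref d p).
Proof.
move=> hd hp; apply: (periodic_eq d) => //.
  exact: periodic_comp (sref_per d p) (sref_per d p).
move=> y; rewrite -[y]/(y : int); move: (y : int) => {}y hy.
have [H|] := boolP (0 <= sref d p y < DD d).
  rewrite (sref_val d p _ hd hp H); move: H; rewrite sref_val //.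
  by rewrite /DD in hy *; srefcases p d; iflia.
rewrite sref_val // => H.
(* Only s_0 leaves the chosen period: it sends 1 to -1 and D - 1 to D + 1. *)
have [E|E] : (p = 0%N /\ y = 1) \/ (p = 0%N /\ y = DD d - 1).
  by move: H; rewrite /DD in hy *; srefcases p d; iflia.
- case: E => -> ->; rewrite /=.
  by rewrite sref_odd // sref_val //; rewrite /DD; iflia.
- case: E => -> ->; have -> : (DD d - 1 == 1) = false by rewrite /DD; lia.
  rewrite !eqxx /=.
  by rewrite [DD d + 1]addrC sref_per sref_val //; rewrite /DD; iflia.
Qed.

Lemma sref_inW d p : (2 <= d)%N -> (p <= d)%N -> inW d (sref d p).
Proof.
move=> hd hp; split; first by exists (sref d p); apply: srefK.
by split; [apply: sref_per | apply: sref_odd].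
Qed.

(** * Exchange condition and length *)

(* [a] is not fixed by any of the reflections x |-> tD - x. *)
Definition nofix d (a : int) := ~~ (((a + a) %% DD d)%Z == 0).

Lemma nofix_inW d g a : inW d g -> nofix d (g a) = nofix d a.
Proof. by move=> W; rewrite /nofix (inW_congN d g). Qed.

Lemma nofixP d a : nofix d a -> forall t, a <> t * DD d /\ a <> d.+1%:Z + t * DD d.
Proof.
move=> /mod0P N t; split=> E; apply: N.
  by exists (t + t); rewrite mulrDl -E.
by exists (1 + t + t); rewrite !mulrDl E /DD; lia.
Qed.

Lemma sref_rb d p : (2 <= d)%N -> (p <= d)%N -> sref d p (root_r d p) = root_l d p.
Proof.
move=> hd hp; rewrite sref_val //; first by rewrite /root_l /root_r /DD; srefcases p d; iflia.
by rewrite /root_r /DD; iflia.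
Qed.

Lemma sref_ra d p : (2 <= d)%N -> (p <= d)%N -> sref d p (root_l d p) = root_r d p.
Proof. by move=> hd hp; rewrite -(sref_rb d p hd hp) srefK. Qed.

Lemma trc_swap_root d p : (2 <= d)%N -> (p <= d)%N ->
  trc d (root_r d p) (root_l d p) =1 sref d p.
Proof.
move=> hd hp x; have := trc_conj d _ (root_l d p) (root_r d p) (sref_inW d p hd hp) (sref d p x).
by rewrite /= sref_ra // sref_rb // srefK // -srefE // !srefK.
Qed.

Lemma trc_opp d j k x : trc d (- j) (- k) x = - trc d j k (- x).
Proof.
rewrite /trc !opprK.
have E c : ((- x + c) %% DD d)%Z == 0 = (((x - c) %% DD d)%Z == 0).
  by rewrite -mod0_opp opprD opprK.
by rewrite !E !opprK; iflia.
Qed.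

Lemma trc_negswap d p : (2 <= d)%N -> (p <= d)%N ->
  trc d (- root_r d p) (- root_l d p) =1 sref d p.
Proof. by move=> hd hp x; rewrite trc_opp trc_swap_root // sref_odd // opprK. Qed.

Lemma sref_moves d p a : (2 <= d)%N -> (p <= d)%N ->
  sref d p a = a \/
  (exists t, a = root_l d p + t * DD d \/ a = - root_r d p + t * DD d) /\
     sref d p a = a + (root_r d p - root_l d p) \/
  (exists t, a = root_r d p + t * DD d \/ a = - root_l d p + t * DD d) /\
     sref d p a = a - (root_r d p - root_l d p).
Proof.
move=> hd hp; rewrite srefE // /trc.
case: ifP => [/mod0P[t E]|_]; first by right; left; split; [exists t; left|]; lia.
case: ifP => [/mod0P[t E]|_]; first by right; right; split; [exists t; right|]; lia.
case: ifP => [/mod0P[t E]|_]; first by right; right; split; [exists t; left|]; lia.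
case: ifP => [/mod0P[t E]|_]; first by right; left; split; [exists t; right|]; lia.
by left.
Qed.

(** Away from the centres, a simple reflection reverses only pairs that it exchanges. Centres must
    be excluded: s_0 also reverses (-1, 0), and s_d reverses (d, d + 1). *)
Lemma sref_inverts d p a b : (2 <= d)%N -> (p <= d)%N -> nofix d a -> nofix d b ->
  a < b -> sref d p b < sref d p a -> trc d a b =1 sref d p.
Proof.
move=> hd hp /nofixP na /nofixP nb ab.
have root t : trc d (root_l d p + t * DD d) (root_r d p + t * DD d) =1 sref d p.
  by move=> x; rewrite trc_shift srefE.
have rootN t : trc d (- root_r d p + t * DD d) (- root_l d p + t * DD d) =1 sref d p.
  by move=> x; rewrite trc_shift trc_negswap.
have R : [\/ [/\ root_l d p = -1 & root_r d p = 1], [/\ root_l d p = d%:Z & root_r d p = d%:Z + 2] |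
    [/\ root_l d p = p%:Z, root_r d p = p%:Z + 1 & 0 < p%:Z < d%:Z]].
  rewrite /root_l /root_r; case: eqP => [_|p0]; first by constructor 1.
  case: eqP => [->|pd]; first by constructor 2.
  by constructor 3; split=> //; lia.
have Rd : root_r d p - root_l d p = 1 \/ root_r d p - root_l d p = 2 by case: R => -[-> ->]; lia.
(* When the ends are two apart, the integer between them is a centre, hence neither [a] nor [b]. *)
have mid t : root_r d p - root_l d p = 2 -> a <> root_l d p + 1 + t * DD d /\ b <> root_l d p + 1 + t * DD d.
  case: R => [[-> ->] _|[-> ->] _|[-> -> _] E]; last by exfalso; lia.
    by rewrite addNr add0r; split; [case: (na t)|case: (nb t)].
  by have -> : d%:Z + 1 = d.+1%:Z; first lia; split; [case: (na t)|case: (nb t)].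
have midN t : root_r d p - root_l d p = 2 -> a <> - root_l d p - 1 + t * DD d /\ b <> - root_l d p - 1 + t * DD d.
  move=> E; move: (mid t E) (mid (t - 1) E).
  have DE : DD d = d%:Z + d%:Z + 2 by rewrite /DD; lia.
  rewrite mulrBl mul1r; move: (t * DD d) => m.
  case: R => [[-> _]|[-> _]|[r1 r2 _]]; last by exfalso; lia.
    by lia.
  by rewrite DE; lia.
case: (sref_moves d p a hd hp) => [Ea|[[[t Ea] Sa]|[_ Sa]]];
  case: (sref_moves d p b hd hp) => [Eb|[[_ Sb]|[[u Eb] Sb]]] ss;
  try lia.
- have {}Rd : root_r d p - root_l d p = 2 by lia.
  have Ea' : a = b - 1 by lia.
  case: Eb => Eb; first by case: (mid u Rd); lia.
  by case: (midN u Rd); lia.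
- have {}Rd : root_r d p - root_l d p = 2 by lia.
  have Eb' : b = a + 1 by lia.
  case: Ea => Ea; first by case: (mid t Rd); lia.
  by case: (midN t Rd); lia.
have DE : DD d = d%:Z + d%:Z + 2 by rewrite /DD; lia.
(* [a] and [b] come with separate periods; as they are close together, the periods differ by at most
   one. *)
have [k Ek] : exists k, u = t + k by exists (u - t); lia.
have bd : b - a < 4 /\ (root_r d p - root_l d p = 1 -> b - a = 1) by lia.
have K : -2 * DD d < k * DD d < 2 * DD d.
  by subst u; rewrite mulrDl in Eb; move: Eb Ea bd; move: (t * DD d) (k * DD d) => m m';
     case: R => -[-> ->]; lia.
have {K} K : k = 0 \/ k = 1 \/ k = -1 by move: K; rewrite DE; nia.
have Eu : b = root_r d p + t * DD d + k * DD d \/ b = - root_l d p + t * DD d + k * DD d.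
  by subst u; rewrite mulrDl in Eb; lia.
(* The third form occurs for p = d, where -(d + 2) is d shifted by one period. *)
have : a = root_l d p + t * DD d /\ b = root_r d p + t * DD d \/
       a = - root_r d p + t * DD d /\ b = - root_l d p + t * DD d \/
       a = root_l d p + (t - 1) * DD d /\ b = root_r d p + (t - 1) * DD d.
  rewrite mulrBl mul1r; move: Ea Eu bd; move: (t * DD d) => m.
  by case: K => [->|[->|->]]; case: R => [[-> ->]|[-> ->]|[-> -> ?]]; rewrite DE => Ea Eu bd; lia.
by case=> [[-> ->]|[[-> ->]|[-> ->]]].
Qed.

Lemma wprod_inW d l : (2 <= d)%N -> word_ok d l -> inW d (wprod d l).
Proof.
move=> hd; elim: l => [_|p l IH /= /andP[hp hl]]; first exact: inW_id.
by apply: inW_comp; [apply: sref_inW|apply: IH].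
Qed.

(** Strong exchange, by induction along the word. Either the tail already reverses x and y, or the
    first letter reverses their images; then that letter is the transposition of the images by
    [sref_inverts], and conjugating through the tail cancels it. *)
Lemma exchange d l x y : (2 <= d)%N -> word_ok d l -> nofix d x -> nofix d y ->
  x < y -> wprod d l y < wprod d l x ->
  exists l', [/\ word_ok d l', (size l').+1 = size l & wprod d l \o trc d x y =1 wprod d l'].
Proof.
move=> hd; elim: l => [|p l IH /= /andP[hp hl]] nx ny xy /=; first by lia.
have Wl := wprod_inW d l hd hl.
have [H|H] := ltP (wprod d l y) (wprod d l x) => lxy.
  have [l' [ok' sz E]] := IH hl nx ny xy H.
  exists (p :: l'); split; rewrite /= ?hp ?sz //.
  by move=> z /=; rewrite -E.
have {}H : wprod d l x < wprod d l y.
  rewrite lt_neqAle H andbT; apply/eqP => /(inW_inj d _ Wl) E; by rewrite E ltxx in xy.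
have nf z : nofix d z -> nofix d (wprod d l z) by rewrite (nofix_inW d).
have E := sref_inverts d p _ _ hd hp (nf x nx) (nf y ny) H lxy.
exists l; split=> // z.
have := trc_conj d _ x y Wl z; rewrite /= => ->.
by rewrite E srefK.
Qed.

Lemma is_len_ext d g g' n : g =1 g' -> is_len d g n -> is_len d g' n.
Proof.
move=> E [[l [ok [sz El]]] M]; split.
  by exists l; split=> //; split=> // z; rewrite El E.
by move=> l' ok' E'; apply: M => // z; rewrite E' E.
Qed.

Lemma word_is_len d g l : word_ok d l -> wprod d l =1 g -> exists n, is_len d g n.
Proof.
have [n] := ubnP (size l); elim: n l => // n IH l sz ok E.
have [[l' [ok' [E' sz']]]|N] :=
  excluded_middle_informative (exists l', word_ok d l' /\ wprod d l' =1 g /\ (size l' < size l)%N).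
  by apply: (IH l') => //; apply: leq_trans sz' _.
exists (size l); split; first by exists l.
move=> l' ok' E'; rewrite leqNgt; apply/negP => sz'; apply: N.
by exists l'.
Qed.

Lemma nofix_root d p : (2 <= d)%N -> (p <= d)%N -> nofix d (root_l d p) /\ nofix d (root_r d p).
Proof.
move=> hd hp; rewrite /nofix /root_l /root_r !mod0_small; by rewrite /DD; iflia.
Qed.

(** As [h] fixes the centres and is symmetric about them, a descent across the ends of s_p already
    shows between p and p + 1. Descents are tested there from now on, uniformly in p. *)
Lemma root_lt d h p : inW d h -> (p <= d)%N -> h p%:Z < h (p%:Z + 1) <-> h (root_l d p) < h (root_r d p).
Proof.
move=> W hp; rewrite /root_l /root_r; case: eqP => [->|p0].
  by rewrite add0r (inW_N d h) // (inW_0 d h) //; move: (h 1) => y; lia.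
case: eqP => [->|pd] //.
have -> : d%:Z + 2 = DD d - d%:Z by rewrite /DD; lia.
have -> : d%:Z + 1 = d.+1%:Z by lia.
by rewrite (inW_refl d h) // (inW_mid d h) //; move: (h _) => y; rewrite /DD; lia.
Qed.

(** [exchange] at the preimages of the two ends deletes a letter at the cost of a reflection on the
    right; conjugation by [g] turns that reflection into s_p on the left. *)
Lemma word_descent d g h l p : (2 <= d)%N -> (p <= d)%N -> word_ok d l -> wprod d l =1 g ->
  inW d h -> cancel h g -> h (root_r d p) < h (root_l d p) ->
  exists l', [/\ word_ok d l', (size l').+1 = size l & wprod d l' =1 sref d p \o g].
Proof.
move=> hd hp ok E W hK lt.
have [na nb] := nofix_root d p hd hp.
have [l' [ok' sz E']] : exists l', [/\ word_ok d l', (size l').+1 = size l &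
    wprod d l \o trc d (h (root_r d p)) (h (root_l d p)) =1 wprod d l'].
  by apply: exchange; rewrite ?(nofix_inW d h) ?E ?hK //; rewrite /root_l /root_r; iflia.
exists l'; split=> // x; rewrite -E'.
rewrite (trc_conj d _ _ _ (wprod_inW d l hd ok)) /= !E !hK.
exact: trc_swap_root.
Qed.

(** Here [h] is the inverse of [g]. One inequality deletes a letter by [word_descent], the other
    prepends p. *)
Lemma len_sref_down d g h p n m : (2 <= d)%N -> (p <= d)%N -> inW d h -> cancel h g ->
  is_len d g n -> is_len d (sref d p \o g) m -> h (p%:Z + 1) < h p%:Z -> n = m.+1.
Proof.
move=> hd hp W hK [[l [ok [sz E]]] M] [[l' [ok' [sz' E']]] M'] lt.
have {}lt : h (root_r d p) < h (root_l d p).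
  rewrite ltNge le_eqVlt; apply/negP => /orP[/eqP/(inW_inj d h W)|].
    by rewrite /root_l /root_r; iflia.
  by move/(root_lt d h p W hp); move: (h _) (h _) lt => y z; lia.
have [l2 [ok2 sz2 E2]] := word_descent d g h l p hd hp ok E W hK lt.
have := M' l2 ok2 E2; rewrite -ltnS sz2 sz => H.
apply/eqP; rewrite eqn_leq H andbT -sz'.
apply: (M (p :: l')); first by rewrite /= hp.
by move=> x; rewrite /= E' /= srefK.
Qed.

Lemma len_sref_up d g h p n m : (2 <= d)%N -> (p <= d)%N -> inW d h -> cancel h g ->
  is_len d g n -> is_len d (sref d p \o g) m -> h p%:Z < h (p%:Z + 1) -> m = n.+1.
Proof.
move=> hd hp W hK Ln Lm lt.
have Ws := sref_inW d p hd hp.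
apply: (len_sref_down d (sref d p \o g) (h \o sref d p) p) => //.
- exact: inW_comp.
- by move=> x; rewrite /= hK srefK.
- by apply: is_len_ext Ln => x; rewrite /= srefK.
rewrite ltNge le_eqVlt; apply/negP => /orP[/eqP/(inW_inj d _ W)/(inW_inj d _ Ws)|].
  by lia.
move/(root_lt d (h \o sref d p) p (inW_comp d _ _ W Ws) hp) => /=.
rewrite sref_ra // sref_rb //; move/(root_lt d h p W hp): lt.
by move: (h _) (h _) => y z; lia.
Qed.

(** Strict growth from the fixed point 0 bounds [h] from below, strict growth up to the fixed point
    d + 1 bounds it from above. *)
Lemma increasing_id d h : inW d h ->
  (forall p, (p <= d)%N -> h p%:Z < h (p%:Z + 1)) -> h =1 id.
Proof.
move=> W up; apply: (inW_ext d) => // [|i Hi]; first exact: inW_id.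
have lo n : (n <= d.+1)%N -> n%:Z <= h n%:Z.
  elim: n => [|n IH] Hn; first by rewrite (inW_0 d h).
  have := up n Hn; have := IH (ltnW Hn).
  by have -> : n%:Z + 1 = n.+1%:Z; [lia|move: (h _) (h _) => y z; lia].
have hi n : (n <= d.+1)%N -> h (d.+1%:Z - n%:Z) <= d.+1%:Z - n%:Z.
  elim: n => [|n IH] Hn; first by rewrite subr0 (inW_mid d h).
  have Hp : (d - n <= d)%N by lia.
  have := up _ Hp; have := IH (ltnW Hn).
  have -> : d.+1%:Z - n.+1%:Z = (d - n)%N%:Z by lia.
  have -> : (d - n)%N%:Z + 1 = d.+1%:Z - n%:Z by lia.
  by move: (h _) (h _) => y z; lia.
case: i Hi => // i Hi; have := lo i; have := hi (d.+1 - i)%N.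
have -> : d.+1%:Z - (d.+1 - i)%N%:Z = i%:Z by lia.
move=> /(_ (leq_subr _ _)) A1 A2; apply/eqP; rewrite eq_le A1 A2 //; lia.
Qed.

(* Decreases when h = g^-1 is sorted by simple reflections, including s_0 and s_d. *)
Definition displacement d (h : int -> int) : int :=
  \sum_(i < d) (h i.+1%:Z - i.+1%:Z) ^+ 2.

Lemma ltr_sum1 (I : finType) (i0 : I) (F G : I -> int) :
  F i0 < G i0 -> (forall i, i != i0 -> F i = G i) -> \sum_i F i < \sum_i G i.
Proof.
by move=> lt E; rewrite (bigD1 i0) //= [ltRHS](bigD1 i0) //= (eq_bigr G) // ltrD2r.
Qed.

Lemma ltr_sum2 (I : finType) (i0 i1 : I) (F G : I -> int) : i0 != i1 ->
  F i0 + F i1 < G i0 + G i1 -> (forall i, i != i0 -> i != i1 -> F i = G i) ->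
  \sum_i F i < \sum_i G i.
Proof.
move=> ne lt E; rewrite (bigD1 i0) //= (bigD1 i1) 1?eq_sym //=.
rewrite [ltRHS](bigD1 i0) //= [in ltRHS](bigD1 i1) 1?eq_sym //= !addrA.
by rewrite (eq_bigr G) ?ltrD2r // => i /andP[n0 n1]; apply: E.
Qed.

(** An interior s_p exchanges two values in the wrong order; s_0 and s_d reflect a single value
    lying on the wrong side of 0 or d + 1. *)
Lemma displacement_descent d h p : (2 <= d)%N -> (p <= d)%N -> inW d h ->
  h (p%:Z + 1) < h p%:Z -> displacement d (h \o sref d p) < displacement d h.
Proof.
move=> hd hp W lt; rewrite /displacement.
have sv (i : nat) : (i < d)%N -> 0 <= i.+1%:Z < DD d by rewrite /DD; lia.
have d0 : (0 < d)%N by lia.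
have d1 : (d.-1 < d)%N by lia.
have [p0|p0] := boolP (p == 0%N).
  rewrite (eqP p0) add0r (inW_0 d h) // in lt.
  apply: (ltr_sum1 _ (Ordinal d0)) => [|i ne] /=.
    by rewrite sref_val ?p0 ?sv //= (inW_N d h) //; move: lt; move: (h _) => y; rewrite !expr2; nia.
  have {ne} ne : nat_of_ord i <> 0%N by move/eqP: ne => ne E; apply: ne; apply: val_inj.
  rewrite sref_val ?p0 ?sv //=; have -> : (i.+1%:Z == 1) = false by lia.
  by have -> : (i.+1%:Z == DD d - 1) = false by have := ltn_ord i; rewrite /DD; lia.
have [pd|pd] := boolP (p == d).
  apply: (ltr_sum1 _ (Ordinal d1)) => [|i ne] /=.
    rewrite prednK // sref_val ?(negbTE p0) ?pd //; last by rewrite /DD; lia.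
    rewrite eqxx; move: lt; rewrite (eqP pd).
    have -> : d%:Z + 2 = DD d - d%:Z by rewrite /DD; lia.
    have -> : d%:Z + 1 = d.+1%:Z by lia.
    by rewrite (inW_refl d h) // (inW_mid d h) // /DD; move: (h _) => y; rewrite !expr2; nia.
  have {ne} ne : nat_of_ord i <> d.-1 by move/eqP: ne => ne E; apply: ne; apply: val_inj.
  have := ltn_ord i => li; rewrite sref_val ?(negbTE p0) ?pd ?sv //=.
  have -> : (i.+1%:Z == d%:Z) = false by lia.
  by have -> : (i.+1%:Z == d%:Z + 2) = false by lia.
have p1 : (p.-1 < d)%N by lia.
have p2 : (p < d)%N by lia.
apply: (ltr_sum2 _ (Ordinal p1) (Ordinal p2)) => [||i n1 n2] /=.
- by apply/eqP => -[]; lia.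
- rewrite prednK ?lt0n // !sref_val ?sv // ?(negbTE p0) ?(negbTE pd); last by rewrite /DD; lia.
  have -> : (p.+1%:Z == p%:Z) || (p.+1%:Z == DD d - p%:Z - 1) = false by rewrite /DD; lia.
  have -> : (p.+1%:Z == p%:Z + 1) || (p.+1%:Z == DD d - p%:Z) = true by lia.
  rewrite eqxx /=; have -> : p.+1%:Z - 1 = p%:Z by lia.
  have E : p.+1%:Z = p%:Z + 1 by lia.
  by rewrite E; move: lt; move: (h _) (h _) => y z; rewrite !expr2; nia.
have {n1} n1 : nat_of_ord i <> p.-1 by move/eqP: n1 => ne E; apply: ne; apply: val_inj.
have {n2} n2 : nat_of_ord i <> p by move/eqP: n2 => ne E; apply: ne; apply: val_inj.
have := ltn_ord i => li; rewrite sref_val ?(negbTE p0) ?(negbTE pd) ?sv //=.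
have -> : (i.+1%:Z == p%:Z) || (i.+1%:Z == DD d - p%:Z - 1) = false by rewrite /DD; lia.
by have -> : (i.+1%:Z == p%:Z + 1) || (i.+1%:Z == DD d - p%:Z) = false by rewrite /DD; lia.
Qed.

(** W is given as a group of bijections; sorting the inverse shows that the simple reflections
    generate it, so that lengths exist. *)
Lemma word_exists d g h : (2 <= d)%N -> inW d h -> cancel g h -> cancel h g ->
  exists l, word_ok d l /\ wprod d l =1 g.
Proof.
move=> hd; have [n] := ubnP `|displacement d h|%N.
elim: n g h => // n IH g h lt W gK hK.
have [[p [hp D]]|N] :=
  excluded_middle_informative (exists p, (p <= d)%N /\ h (p%:Z + 1) < h p%:Z).
  have Dlt := displacement_descent d h p hd hp W D.
  have pos f : 0 <= displacement d f by apply: sumr_ge0 => i _; apply: sqr_ge0.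
  have [||||l [ok E]] := IH (sref d p \o g) (h \o sref d p).
  - by move: (pos h) (pos (h \o sref d p)); lia.
  - by apply: inW_comp => //; apply: sref_inW.
  - by move=> x; rewrite /= srefK.
  - by move=> x; rewrite /= hK srefK.
  exists (p :: l); split; first by rewrite /= hp.
  by move=> x; rewrite /= E /= srefK.
exists [::]; split=> // x /=.
have id_h : h =1 id.
  apply: (increasing_id d) => // p hp; rewrite ltNge le_eqVlt; apply/negP => /orP[/eqP|H].
    by move/(inW_inj d h W); lia.
  by apply: N; exists p.
by rewrite -{1}(gK x) id_h.
Qed.

Lemma is_len_exists d g : (2 <= d)%N -> inW d g -> exists n, is_len d g n.
Proof.
move=> hd W; have [h [gK hK Wh]] := inWP d g W.
by have [l [ok E]] := word_exists d g h hd Wh gK hK; apply: word_is_len E.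
Qed.

Lemma len_add_sref d g h p : (2 <= d)%N -> (p <= d)%N -> inW d h -> cancel h g ->
  h p%:Z < h (p%:Z + 1) -> len_add d (sref d p) g.
Proof.
move=> hd hp W hK lt a b c La Lb Lc.
rewrite (len_sref_up d g h p b c) //.
have [n0 L0] := is_len_exists d id hd (inW_id d).
have n00 : n0 = 0%N by case: L0 => _ /(_ [::] isT (frefl _)); rewrite leqn0 => /eqP.
rewrite n00 in L0.
have La' : is_len d (sref d p \o id) a by [].
have -> : a = 1%N by apply: (len_sref_up d id id p 0 a) => //; [apply: inW_id|lia].
by [].
Qed.

Lemma len_add_sref_lt d g h p : (2 <= d)%N -> (p <= d)%N -> inW d g -> inW d h -> cancel h g ->
  len_add d (sref d p) g -> h p%:Z < h (p%:Z + 1).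
Proof.
move=> hd hp Wg W hK la; rewrite ltNge le_eqVlt; apply/negP => /orP[/eqP/(inW_inj d h W)|lt].
  by lia.
have Ws := sref_inW d p hd hp.
have [a La] := is_len_exists d _ hd Ws.
have [b Lb] := is_len_exists d _ hd Wg.
have [c Lc] := is_len_exists d _ hd (inW_comp d _ _ Ws Wg).
have := la a b c La Lb Lc; have := len_sref_down d g h p b c hd hp W hK Lb Lc lt.
by lia.
Qed.

(** * Minimal coset representatives and Hecke relations *)

Lemma inDmin_step r' d lam g h p : (2 <= d)%N -> inDmin r' d lam g ->
  inW d h -> cancel h g -> par_ok r' d lam p -> h p%:Z < h (p%:Z + 1).
Proof.
move=> hd [Wg D] W hK ok; have /andP[hp _] := ok.
apply: (len_add_sref_lt d g h p) => //; apply: D.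
by exists [:: p]; rewrite /= ok.
Qed.

Lemma step_mono (h : int -> int) (a b : nat) : (a < b)%N ->
  (forall p, (a <= p < b)%N -> h p%:Z < h (p%:Z + 1)) -> h a%:Z < h b%:Z.
Proof.
elim: b => // b IH; rewrite ltnS leq_eqVlt => /orP[/eqP->|lt] up.
  by have -> : b.+1%:Z = b%:Z + 1; [lia|apply: up; lia].
apply: (lt_trans (IH lt _)) => [p Hp|]; first by apply: up; lia.
by have -> : b.+1%:Z = b%:Z + 1; [lia|apply: up; lia].
Qed.

Lemma par_okP r' d lam p : (p <= d)%N -> (forall i, (i <= r')%N -> psum lam i <> p) ->
  par_ok r' d lam p.
Proof.
move=> hp N; rewrite /par_ok hp; apply/mapP => -[i]; rewrite mem_iota => /andP[_ hi] E.
by apply: (N i); rewrite // -ltnS.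
Qed.

Lemma inDmin_mono r' d lam g h (a b : nat) : (2 <= d)%N -> inDmin r' d lam g ->
  inW d h -> cancel h g -> (a < b <= d.+1)%N ->
  (forall i, (i <= r')%N -> ~ (a <= psum lam i < b)%N) -> h a%:Z < h b%:Z.
Proof.
move=> hd D W hK /andP[ab bd] N; apply: step_mono => // p Hp.
apply: (inDmin_step r' d lam g) => //; apply: par_okP => [|i Hi E]; first by lia.
by apply: (N i Hi); rewrite E.
Qed.

(** Put s = s_p. Both w and s w lie in W_mu, so their lengths add to that of [g2], and s lengthens w
    because w is minimal for [delta]. Hence s lengthens w g2, whose inverse therefore ascends at
    p. *)
Lemma inDmin_comp_step r' d mu r'' delta w g2 X p : (2 <= d)%N -> inDmin r' d mu g2 ->
  inDmin r'' d delta w -> inWpar r' d mu w -> inW d X -> cancel X (w \o g2) ->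
  par_ok r' d mu p -> par_ok r'' d delta p -> X p%:Z < X (p%:Z + 1).
Proof.
move=> hd [Wg2 D2] [Ww Dw] Pw WX XK okm okd; have /andP[hp _] := okm.
have Ws := sref_inW d p hd hp.
apply: (len_add_sref_lt d (w \o g2) X p) => //; first exact: inW_comp.
move=> a b c La Lb Lc.
have [n1 L1] := is_len_exists d _ hd Ww.
have [n2 L2] := is_len_exists d _ hd Wg2.
have [n3 L3] := is_len_exists d _ hd (inW_comp d _ _ Ws Ww).
have Psw : inWpar r' d mu (sref d p \o w).
  case: Pw => l [al El]; exists (p :: l); rewrite /= okm; split=> // x.
  by rewrite /= El.
have Ps : inWpar r'' d delta (sref d p) by exists [:: p]; rewrite /= okd.
have E3 := Dw _ Ps _ _ _ La L1 L3.
by rewrite (D2 _ Psw _ _ _ L3 L2 Lc) (D2 _ Pw _ _ _ L1 L2 Lb) E3 addnA.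
Qed.

Section Hecke.
Variables (d : nat) (R : nzRingType) (v : R) (T : (int -> int) -> R).
Hypotheses (hd : (2 <= d)%N) (HH : hecke_rel d R v T).

Lemma T_ext x y : x =1 y -> T x = T y.
Proof. by move=> E; congr T; apply: functional_extensionality. Qed.

Lemma comm_v n a : a * v ^+ n = v ^+ n * a.
Proof. by case: HH => C _; apply: commrX; rewrite /GRing.comm C. Qed.

Lemma T_sref_up p y h : (p <= d)%N -> inW d y -> inW d h -> cancel h y ->
  h p%:Z < h (p%:Z + 1) -> T (sref d p) * T y = T (sref d p \o y).
Proof.
case: HH => _ [_ [_ [M _]]] hp Wy Wh hK lt; rewrite M //; first exact: sref_inW.
exact: len_add_sref lt.
Qed.

(** Write T_y = T_s T_(s y), as s y is shorter, and apply T_s^2 = (v^2 - 1) T_s + v^2. *)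
Lemma T_sref_down p y h : (p <= d)%N -> inW d y -> inW d h -> cancel h y ->
  h (p%:Z + 1) < h p%:Z ->
  T (sref d p) * T y = v ^+ 2 * T (sref d p \o y) + (v ^+ 2 - 1) * T y.
Proof.
move=> hp Wy Wh hK lt; have Ws := sref_inW d p hd hp.
have E : T y = T (sref d p) * T (sref d p \o y).
  rewrite (T_sref_up p _ (h \o sref d p)) //; try exact: inW_comp.
  - by apply: T_ext => x /=; rewrite srefK.
  - by move=> x /=; rewrite hK srefK.
  move: lt => /=; have [a b] := (root_lt d h p Wh hp, root_lt d (h \o sref d p) p (inW_comp d _ _ Wh Ws) hp).
  move=> lt; apply/b; rewrite /= sref_ra // sref_rb //.
  rewrite ltNge le_eqVlt; apply/negP => /orP[/eqP/(inW_inj d h Wh)|].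
    by rewrite /root_l /root_r; iflia.
  by move/a; move: lt; move: (h _) (h _) => u z; lia.
have Q : T (sref d p) * T (sref d p) = v ^+ 2 * T (sref d p) - T (sref d p) + v ^+ 2.
  case: HH => _ [_ [_ [_ /(_ p hp)]]].
  rewrite mulrDl mul1r mulrBr -comm_v => /eqP; rewrite addrA subr_eq0 => /eqP H.
  by rewrite -{2}H addrACA addNr addr0 addrC subrK.
rewrite {1}E mulrA Q mulrDl mulrBl -mulrA -E addrC mulrBl mul1r.
by [].
Qed.
End Hecke.

(** * Matchings and their involutions *)

Lemma trc_inner d (j k i : nat) : (0 < j <= d)%N -> (0 < k <= d)%N -> (i <= d)%N ->
  trc d j k i = if i == j then k%:Z else if i == k then j%:Z else i%:Z.
Proof.
move=> hj hk hi; rewrite /trc !mod0_small; try (rewrite /DD; lia).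
have -> : [|| i%:Z - j%:Z == 0, i%:Z - j%:Z == DD d, i%:Z - j%:Z == - DD d,
  i%:Z - j%:Z == DD d + DD d, i%:Z - j%:Z == - DD d - DD d, i%:Z - j%:Z == 3%:Z * DD d |
  i%:Z - j%:Z == - 3%:Z * DD d] = (i == j) by rewrite /DD; lia.
have -> : [|| i%:Z - k%:Z == 0, i%:Z - k%:Z == DD d, i%:Z - k%:Z == - DD d,
  i%:Z - k%:Z == DD d + DD d, i%:Z - k%:Z == - DD d - DD d, i%:Z - k%:Z == 3%:Z * DD d |
  i%:Z - k%:Z == - 3%:Z * DD d] = (i == k) by rewrite /DD; lia.
by rewrite /DD; iflia.
Qed.

Lemma sref_inner d p i : (0 < p < d)%N -> (i <= d)%N ->
  sref d p i = (if i == p then p.+1 else if i == p.+1 then p else i)%:Z.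
Proof.
move=> hp hi; rewrite srefE; try lia.
have -> : root_l d p = p%:Z by rewrite /root_l; iflia.
have -> : root_r d p = p.+1%:Z by rewrite /root_r; iflia.
by rewrite trc_inner; try lia; iflia.
Qed.

(** Conjugation by s_k moves the right end from k to k + 1, starting from the simple reflection
    s_j. *)
Lemma trc_inW d (j k : nat) : (2 <= d)%N -> (0 < j)%N -> (j < k <= d)%N -> inW d (trc d j k).
Proof.
move=> hd hj; elim: k => // k IH hk.
have [->|jk] := eqVneq j k.
  suff -> : trc d k k.+1 = sref d k by apply: sref_inW => //; lia.
  apply: functional_extensionality => x; rewrite srefE //; last lia.
  have -> : root_l d k = k%:Z by rewrite /root_l; iflia.
  by have -> : root_r d k = k.+1%:Z by rewrite /root_r; iflia.
have Ws : inW d (sref d k) by apply: sref_inW; lia.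
suff -> : trc d j k.+1 = sref d k \o trc d j k \o sref d k.
  by apply: inW_comp => //; apply: inW_comp => //; apply: IH; lia.
apply: functional_extensionality => x.
have := trc_conj d _ j k Ws (sref d k x); rewrite /= srefK //; last lia.
rewrite !sref_inner; try lia.
have -> : (j == k.+1) = false by lia.
by rewrite eqxx (negbTE jk).
Qed.

Section Matchings.
Variables (d : nat) (X : int -> int) (B : {set 'I_d.+1 * 'I_d.+1}).
Implicit Types (M : {set 'I_d.+1 * 'I_d.+1}) (q : 'I_d.+1 * 'I_d.+1).
Hypothesis hd : (2 <= d)%N.
Hypothesis B1 : forall q, q \in B -> (0 < q.1 < q.2)%N.
Hypothesis B2 : forall q q', q \in B -> q' \in B -> q.1 != q'.2.

Definition matching M := [forall p in M, forall p' in M,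
  ((p.1 == p'.1) ==> (p == p')) && ((p.2 == p'.2) ==> (p == p'))].

Lemma matchingP M : reflect (forall q q', q \in M -> q' \in M ->
  (q.1 = q'.1 -> q = q') /\ (q.2 = q'.2 -> q = q')) (matching M).
Proof.
apply: (iffP forall_inP) => [H q q' qM q'M|H q qM].
  have /forall_inP /(_ q' q'M) /andP[/implyP a /implyP b] := H q qM.
  by split=> E; apply/eqP; [apply: a|apply: b]; rewrite E.
apply/forall_inP => q' q'M; have [a b] := H q q' qM q'M.
by apply/andP; split; apply/implyP => /eqP E; apply/eqP; [apply: a|apply: b].
Qed.

(** [sigmaK] with an arbitrary list in place of [enum M], which makes induction possible. *)
Definition list_prod (l : seq ('I_d.+1 * 'I_d.+1)) : int -> int :=
  foldr (fun p f => trc d (pair_int d p).1 (pair_int d p).2 \o f) id l.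

Definition disjoint_pairs q q' := [&& q.1 != q'.1, q.2 != q'.2, q.1 != q'.2 & q.2 != q'.1].

Definition disjoint_list (l : seq ('I_d.+1 * 'I_d.+1)) := uniq l /\
  (forall q q', q \in l -> q' \in l -> q != q' -> disjoint_pairs q q') /\ {subset l <= B}.

Lemma disjoint_list_cons q l : disjoint_list (q :: l) -> disjoint_list l.
Proof.
move=> [/= /andP[_ u] [H S]]; split=> //; split=> [p p' pl p'l|p pl].
  by apply: H; rewrite inE ?pl ?p'l orbT.
by apply: S; rewrite inE pl orbT.
Qed.

Lemma trc_pair q (i : 'I_d.+1) : q \in B ->
  trc d q.1 q.2 i = (if i == q.1 then q.2 else if i == q.2 then q.1 else i)%:Z.
Proof.
move=> /B1 H; have := ltn_ord q.2; have := ltn_ord i => hi hq.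
by rewrite trc_inner; try lia; rewrite -!val_eqE /=; repeat case: ifP.
Qed.

Lemma list_prod_inW l : disjoint_list l -> inW d (list_prod l).
Proof.
elim: l => [_|q l IH okq] /=; first exact: inW_id.
apply: inW_comp; last by apply/IH/disjoint_list_cons/okq.
have [_ [_ /(_ q (mem_head _ _)) /B1 H]] := okq.
by have := ltn_ord q.2 => ?; apply: trc_inW => //; lia.
Qed.

Lemma list_prod_out l (i : 'I_d.+1) : disjoint_list l -> (forall q, q \in l -> q.1 != i /\ q.2 != i) ->
  list_prod l i = i.
Proof.
elim: l => [//|q l IH okq N] /=; rewrite IH; [|exact: disjoint_list_cons okq|]; last first.
  by move=> p pl; apply: N; rewrite inE pl orbT.
have [_ [_ /(_ q (mem_head _ _)) qB]] := okq.
rewrite trc_pair //; have [] := N q (mem_head _ _).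
by rewrite !(eq_sym _ i) => /negbTE -> /negbTE ->.
Qed.

Lemma list_prod_in l q : disjoint_list l -> q \in l -> list_prod l q.1 = q.2 /\ list_prod l q.2 = q.1.
Proof.
elim: l => [//|p l IH okp] /=; rewrite inE => /orP[/eqP->|ql].
  have [/= /andP[pl _] [H /(_ p (mem_head _ _)) pB]] := okp.
  have dj q' : q' \in l -> disjoint_pairs p q'.
    move=> q'l; apply: H; rewrite ?mem_head ?inE ?q'l ?orbT //.
    by apply: contraNneq pl => ->.
  have o1 : list_prod l p.1 = p.1.
    by apply: list_prod_out (disjoint_list_cons _ _ okp) _ => q' /dj /and4P[]; rewrite ![_ == p.1]eq_sym.
  have o2 : list_prod l p.2 = p.2.
    by apply: list_prod_out (disjoint_list_cons _ _ okp) _ => q' /dj /and4P[]; rewrite ![_ == p.2]eq_sym.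
  rewrite o1 o2 !trc_pair // !eqxx; split=> //.
  have := B1 p pB; case: eqP => // -> ; lia.
have [/= /andP[pl _] [H S]] := okp.
have pB := S p (mem_head _ _).
have [-> ->] := IH (disjoint_list_cons _ _ okp) ql.
have /and4P[a b c e] : disjoint_pairs p q.
  apply: H; rewrite ?mem_head ?inE ?ql ?orbT //.
  by apply: contraNneq pl => ->.
rewrite !trc_pair // !(eq_sym _ p.1) !(eq_sym _ p.2).
by rewrite (negbTE a) (negbTE b) (negbTE c) (negbTE e).
Qed.

(** Distinct pairs of a matching share no left end and no right end, and [B2] keeps a left end of
    one from being a right end of the other. The order chosen by [enum] is thus immaterial. *)
Lemma disjoint_list_enum M : matching M -> M \subset B -> disjoint_list (enum M).
Proof.
move=> /matchingP mM /subsetP sM; split; first exact: enum_uniq.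
split=> [q q'|q]; rewrite ?mem_enum; last exact: sM.
move=> qM q'M ne; have [a b] := mM q q' qM q'M.
apply/and4P; split; try by apply: contraNneq ne => E; apply/eqP; auto.
  by apply: B2; apply: sM.
by rewrite eq_sym; apply: B2; apply: sM.
Qed.

Lemma sigmaK_inW M : matching M -> M \subset B -> inW d (sigmaK d M).
Proof. by move=> mM sM; apply: (list_prod_inW (enum M)); apply: disjoint_list_enum. Qed.

Lemma sigmaK_in M q : matching M -> M \subset B -> q \in M ->
  sigmaK d M q.1 = q.2 /\ sigmaK d M q.2 = q.1.
Proof.
by move=> mM sM qM; apply: (list_prod_in (enum M)); rewrite ?mem_enum //; apply: disjoint_list_enum.
Qed.

Lemma sigmaK_out M (i : 'I_d.+1) : matching M -> M \subset B ->
  (forall q, q \in M -> q.1 != i /\ q.2 != i) -> sigmaK d M i = i.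
Proof.
move=> mM sM N; apply: (list_prod_out (enum M)); first exact: disjoint_list_enum.
by move=> q; rewrite mem_enum; apply: N.
Qed.

Lemma sigmaK_cases M (i : 'I_d.+1) : matching M -> M \subset B ->
  [\/ exists2 k, (i, k) \in M & sigmaK d M i = k,
      exists2 j, (j, i) \in M & sigmaK d M i = j |
      (forall q, q \in M -> q.1 != i /\ q.2 != i) /\ sigmaK d M i = i].
Proof.
move=> mM sM; have [/exists_inP[[a k] /= kM /eqP E]|N1] := boolP [exists q in M, q.1 == i].
  by subst a; constructor 1; exists k => //; have [-> _] := sigmaK_in M _ mM sM kM.
have [/exists_inP[[j a] /= jM /eqP E]|N2] := boolP [exists q in M, q.2 == i].
  by subst a; constructor 2; exists j => //; have [_ ->] := sigmaK_in M _ mM sM jM.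
have N q : q \in M -> q.1 != i /\ q.2 != i.
  move=> qM; split; [apply: contra N1|apply: contra N2] => E; apply/exists_inP; by exists q.
by constructor 3; split=> //; apply: sigmaK_out.
Qed.

Lemma sigmaKK M : matching M -> M \subset B -> involutive (sigmaK d M).
Proof.
move=> mM sM; have W := sigmaK_inW M mM sM.
apply: (inW_ext d) => [||i Hi]; [exact: inW_comp|exact: inW_id|].
have li : (`|i| < d.+1)%N by lia.
have -> : i = (Ordinal li)%:Z by rewrite /=; lia.
case: (sigmaK_cases M (Ordinal li) mM sM) => [[k kM /= ->]|[j jM /= ->]|[_ /= E]].
- by have [_ /= ->] := sigmaK_in M _ mM sM kM.
- by have [/= -> _] := sigmaK_in M _ mM sM jM.
- by rewrite !E.
Qed.

Lemma sigmaK_add M q : matching (q |: M) -> q |: M \subset B -> q \notin M ->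
  sigmaK d (q |: M) =1 trc d q.1 q.2 \o sigmaK d M.
Proof.
move=> mU sU qM; have qB : q \in B by apply: (subsetP sU); rewrite setU11.
have sM : M \subset B by apply: subset_trans sU; apply: subsetUr.
have mM : matching M.
  by apply/matchingP => a b aM bM; apply: (matchingP _ mU); rewrite inE ?aM ?bM orbT.
have Wq : inW d (trc d q.1 q.2).
  have := B1 q qB; have := ltn_ord q.2 => ??; apply: trc_inW => //; lia.
have dj p : p \in M -> disjoint_pairs q p.
  have [_ [H _]] := disjoint_list_enum _ mU sU.
  move=> pM; apply: H; rewrite ?mem_enum ?setU11 ?inE ?pM ?orbT //.
  by apply: contraNneq qM => ->.
apply: (inW_ext d) => [||i Hi]; [exact: sigmaK_inW|by apply: inW_comp => //; apply: sigmaK_inW|].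
have li : (`|i| < d.+1)%N by lia.
have -> : i = (Ordinal li)%:Z by rewrite /=; lia.
have inU p : p \in M -> p \in q |: M by move=> pM; rewrite inE pM orbT.
move: (Ordinal li) => {Hi li} o.
case: (sigmaK_cases M o mM sM) => [[k kM /= ->]|[j jM /= ->]|[N /= ->]].
- have [/= -> _] := sigmaK_in _ _ mU sU (inU _ kM).
  have /and4P[/= _ b c _] := dj _ kM.
  by rewrite trc_pair // !(eq_sym k) (negbTE c) (negbTE b).
- have [_ /= ->] := sigmaK_in _ _ mU sU (inU _ jM).
  have /and4P[/= a _ _ e] := dj _ jM.
  by rewrite trc_pair // !(eq_sym j) (negbTE a) (negbTE e).
have [q1 q2] := sigmaK_in _ _ mU sU (setU11 q M).
have := trc_pair q o qB; rewrite /= => ->.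
have [->|n1] := eqVneq o q.1; first by rewrite q1.
have [->|n2] := eqVneq o q.2; first by rewrite q2.
apply: (sigmaK_out (q |: M) o) => // p; rewrite !inE => /orP[/eqP->|/N //].
by rewrite !(eq_sym _ o).
Qed.
End Matchings.

(** * Adding one inversion *)

Section AddInversion.
Variables (d : nat) (X : int -> int) (B : {set 'I_d.+1 * 'I_d.+1}).
Implicit Types (M F : {set 'I_d.+1 * 'I_d.+1}) (q : 'I_d.+1 * 'I_d.+1).
Hypothesis hd : (2 <= d)%N.
Hypothesis WX : inW d X.
Hypothesis B1 : forall q, q \in B -> (0 < q.1 < q.2)%N.
Hypothesis B2 : forall q q', q \in B -> q' \in B -> q.1 != q'.2.
Hypothesis B3 : forall i k k', (i, k) \in B -> (i, k') \in B -> (k < k')%N -> X k < X k'.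
Hypothesis B4 : forall i i' k, (i, k) \in B -> (i', k) \in B -> (i < i')%N -> X i < X i'.

Definition admissible M := matching d M && [forall q in M, X q.2 < X q.1].

Definition h_set F (s : int -> int) :=
  [set q in F | (X q.2 < X (s q.1)) && (X (s q.2) < X q.1)].

Variables (F : {set 'I_d.+1 * 'I_d.+1}) (j k : 'I_d.+1).
Hypothesis sF : F \subset B.
Hypothesis jkB : (j, k) \in B.
Hypothesis jkF : (j, k) \notin F.
(** (j, k) will be the inversion created last, hence extreme among the pairs of [F] at j and at k.
    Through [B3] and [B4] this orders X at any partner of j or k. *)
Hypothesis C1 : forall k', (j, k') \in F -> (k' < k)%N.
Hypothesis C2 : forall j', (j', k) \in F -> (j < j')%N.

Lemma admissible_lt M q : admissible M -> q \in M -> X q.2 < X q.1.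
Proof. by case/andP=> _ /forall_inP; apply. Qed.

Lemma jk_cases M : admissible M -> M \subset F ->
  (exists2 k', (j, k') \in M & sigmaK d M j = k') \/
      (forall q, q \in M -> q.1 != j /\ q.2 != j) /\ sigmaK d M j = j.
Proof.
move=> /andP[mM _] sM; have sB := subset_trans sM sF.
case: (sigmaK_cases d B hd B1 B2 M j mM sB) => [H|[i iM _]|H].
- by left.
- by have /eqP := B2 _ _ jkB (subsetP sB _ iM).
- by right.
Qed.

Lemma kj_cases M : admissible M -> M \subset F ->
  (exists2 j', (j', k) \in M & sigmaK d M k = j') \/
      (forall q, q \in M -> q.1 != k /\ q.2 != k) /\ sigmaK d M k = k.
Proof.
move=> /andP[mM _] sM; have sB := subset_trans sM sF.
case: (sigmaK_cases d B hd B1 B2 M k mM sB) => [[i iM _]|H|H].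
- by have /eqP := B2 _ _ (subsetP sB _ iM) jkB.
- by left.
- by right.
Qed.

Lemma partner_lt k' : (j, k') \in F -> X k' < X k.
Proof. by move=> H; apply: (B3 j) => //; [apply: (subsetP sF)|apply: C1]. Qed.

Lemma partner_gt j' : (j', k) \in F -> X j < X j'.
Proof. by move=> H; apply: (B4 j j' k) => //; [apply: (subsetP sF)|apply: C2]. Qed.

Lemma HsetU1 s : h_set ((j, k) |: F) s =
  if (X k < X (s j)) && (X (s k) < X j) then (j, k) |: h_set F s else h_set F s.
Proof.
by case: ifP => c; apply/setP => q; rewrite !inE;
  have [->|_] := eqVneq q (j, k); rewrite /= ?c ?(negbTE jkF).
Qed.

Lemma admissible_add M : admissible M -> M \subset F -> (forall q, q \in M -> q.1 != j /\ q.2 != k) ->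
  X k < X j -> admissible ((j, k) |: M).
Proof.
move=> /andP[/matchingP mM /forall_inP lM] sM N lt; apply/andP; split.
  apply/matchingP => q q'; rewrite !inE => /orP[/eqP->|qM] /orP[/eqP->|q'M] //=.
  - by have [/eqP a /eqP b] := N _ q'M; split=> E; [case: a|case: b].
  - by have [/eqP a /eqP b] := N _ qM; split.
  - exact: mM.
by apply/forall_inP => q; rewrite !inE => /orP[/eqP->|/lM].
Qed.

Lemma admissible_sub M : admissible ((j, k) |: M) -> admissible M.
Proof.
move=> /andP[/matchingP mM /forall_inP lM]; apply/andP; split.
  by apply/matchingP => q q' qM q'M; apply: mM; rewrite inE ?qM ?q'M orbT.
by apply/forall_inP => q qM; apply: lM; rewrite inE qM orbT.
Qed.

(** If (j, k) were counted by h, [partner_lt] would exclude a partner of j and [partner_gt] a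
    partner of k, and with both unmatched the assumption reads X j < X k. The same cases forbid
    adding the pair: an end is taken, or X is in the wrong order. *)
Lemma step_up M : admissible M -> M \subset F -> X (sigmaK d M j) < X (sigmaK d M k) ->
  h_set ((j, k) |: F) (sigmaK d M) = h_set F (sigmaK d M) /\ ~~ admissible ((j, k) |: M).
Proof.
move=> ok sM lt; split.
  rewrite HsetU1; case: ifP => // /andP[H1 H2].
  case: (jk_cases M ok sM) => [[k' k'M E]|[_ E]].
    rewrite E in H1; have := partner_lt _ (subsetP sM _ k'M).
    by move: (X _) (X _) H1 => a b; lia.
  case: (kj_cases M ok sM) => [[j' j'M E']|[_ E']].
    rewrite E' in H2; have := partner_gt _ (subsetP sM _ j'M).
    by move: (X _) (X _) H2 => a b; lia.
  by rewrite E E' in lt H1; move: (X _) (X _) lt H1 => a b; lia.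
have jkM : (j, k) \notin M by apply: contra jkF; apply: (subsetP sM).
apply/negP => ok'; have lt' := admissible_lt _ _ ok' (setU11 _ _); have /andP[/matchingP mU _] := ok'.
case: (jk_cases M ok sM) => [[k' k'M _]|[_ E]].
  have [/(_ erefl) H _] := mU (j, k) (j, k') (setU11 _ _) (setU1r _ k'M).
  by rewrite H k'M in jkM.
case: (kj_cases M ok sM) => [[j' j'M _]|[_ E']].
  have [_ /(_ erefl) H] := mU (j, k) (j', k) (setU11 _ _) (setU1r _ j'M).
  by rewrite H j'M in jkM.
by rewrite E E' /= in lt lt'; move: (X _) (X _) lt lt' => a b; lia.
Qed.

(** Why j and k are unmatched: partners k' of j and j' of k would satisfy X k' < X k, X j < X j'
    and, by admissibility, X k < X j'. Whichever of them exist, they contradict X (sigma k) < X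
    (sigma j). *)
Lemma step_down M : admissible M -> M \subset F -> X (sigmaK d M k) < X (sigmaK d M j) ->
  [/\ admissible ((j, k) |: M),
      #|h_set ((j, k) |: F) (sigmaK d M)| = #|h_set F (sigmaK d M)|.+1 &
      h_set ((j, k) |: F) (sigmaK d ((j, k) |: M)) = h_set F (sigmaK d M)].
Proof.
move=> ok sM lt.
have jkM : (j, k) \notin M by apply: contra jkF; apply: (subsetP sM).
have [nj Ej] : (forall q, q \in M -> q.1 != j /\ q.2 != j) /\ sigmaK d M j = j.
  case: (jk_cases M ok sM) => [[k' k'M E]|//]; exfalso.
  have l1 := partner_lt _ (subsetP sM _ k'M).
  case: (kj_cases M ok sM) => [[j' j'M E']|[_ E']]; rewrite E E' in lt.
    by have := admissible_lt _ _ ok j'M; rewrite /=; move: (X _) (X _) (X _) l1 lt => a b c; lia.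
  by move: (X _) (X _) l1 lt => a b; lia.
have [nk Ek] : (forall q, q \in M -> q.1 != k /\ q.2 != k) /\ sigmaK d M k = k.
  case: (kj_cases M ok sM) => [[j' j'M E']|//]; exfalso.
  have l1 := partner_gt _ (subsetP sM _ j'M); rewrite Ej E' in lt.
  by move: (X _) (X _) l1 lt => a b; lia.
rewrite Ej Ek in lt.
have okU : admissible ((j, k) |: M).
  by apply: admissible_add => // q qM; have [a _] := nj q qM; have [_ b] := nk q qM.
split=> //.
  by rewrite HsetU1 Ej Ek lt /= cardsU1 inE (negbTE jkF).
have mU : matching d ((j, k) |: M) by case/andP: okU.
have sU : (j, k) |: M \subset B by rewrite subUset sub1set jkB (subset_trans sM).
have [/= Uj Uk] := sigmaK_in d B hd B1 B2 _ (j, k) mU sU (setU11 _ _).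
(* With (j, k) added, that pair is not counted, as sigma j = k. A pair (j, b) or (a, k) of [F] keeps
   its status: by X b < X k < X j, respectively X k < X j < X a, the one comparison that changes is
   true before and after. *)
rewrite HsetU1 Uj ltxx /=; apply/setP => -[a b]; rewrite !inE /=.
case abF: ((a, b) \in F) => //=; have abB := subsetP sF _ abF.
have sig (i : 'I_d.+1) : i != j -> i != k -> sigmaK d ((j, k) |: M) i = sigmaK d M i.
  move=> ij ik; rewrite (sigmaK_add d B) // [LHS]/=.
  have mM : matching d M by case/andP: ok.
  have T q (z : 'I_d.+1) : q \in B -> z != q.1 -> z != q.2 -> trc d q.1 q.2 z = z.
    by move=> qB n1 n2; rewrite (trc_pair d B) // (negbTE n1) (negbTE n2).
  case: (sigmaK_cases d B hd B1 B2 M i mM (subset_trans sM sF)) => [[c cM ->]|[c cM ->]|[_ ->]].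
  - by apply: (T (j, k)) => //; [have [_] := nj _ cM|have [_] := nk _ cM].
  - by apply: (T (j, k)) => //; [have [] := nj _ cM|have [] := nk _ cM].
  - exact: (T (j, k)).
have ak : a != k by apply: (B2 (a, b) (j, k)).
have bj : b != j by rewrite eq_sym; apply: (B2 (j, k) (a, b)).
have [aj|aj] := eqVneq a j.
  subst a; have bk : b != k by apply/eqP => E; rewrite E (negbTE jkF) in abF.
  have l1 := partner_lt _ abF; rewrite Uj Ej sig // l1.
  by rewrite (lt_trans l1 lt).
have [bk|bk] := eqVneq b k; last by rewrite !sig.
subst b; have l1 := partner_gt _ abF; rewrite Uk Ek sig // l1.
by rewrite (lt_trans lt l1).
Qed.
End AddInversion.

(** * Induction on the number of inversions *)

Definition preserves d (g : int -> int) := forall i, 1 <= i <= d%:Z -> 1 <= g i <= d%:Z.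

(** A point outside [1..d] is a translate of a centre, or a nontrivial translate of a point of
    [1..d], or a translate of the negative of one; [g] sends each of these outside [1..d] again. *)
Lemma preserves_inv d g h : inW d g -> inW d h -> cancel h g -> preserves d g -> preserves d h.
Proof.
move=> Wg Wh hK P y Hy; have [t [z [E Hz]]] := int_reduce d (h y).
have Ey : y = g z + t * DD d by rewrite -(inW_D d g) // -E hK.
have Q : t * DD d <= - DD d \/ t = 0 \/ DD d <= t * DD d.
  have [t0|t0|->] := ltgtP t 0; [left|right; right|by right; left]; rewrite /DD; nia.
have z0 : z <> 0.
  by move=> z0; rewrite z0 (inW_0 d g) // in Ey; move: Ey Hy; rewrite /DD in Q *; lia.
have z1 : z <> d.+1%:Z.
  by move=> z1; rewrite z1 (inW_mid d g) // in Ey; move: Ey Hy; rewrite /DD in Q *; lia.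
have [H|H] := boolP (1 <= z <= d%:Z).
  have gz := P z H; suff t0 : t = 0 by rewrite E t0 mul0r addr0.
  by move: Ey Hy gz; move: (g z) => u; rewrite /DD in Q *; lia.
have H' : 1 <= DD d - z <= d%:Z by rewrite /DD in Hz *; lia.
have := P _ H'; rewrite (inW_refl d g) // => gz; exfalso.
by move: Ey Hy gz; move: (g z) => u; rewrite /DD in Q *; lia.
Qed.

Section MainSum.
Variables (d : nat) (R : nzRingType) (v : R) (T : (int -> int) -> R).
Hypotheses (hd : (2 <= d)%N) (HH : hecke_rel d R v T).
Variables (x X : int -> int) (B : {set 'I_d.+1 * 'I_d.+1}).
Implicit Types (M F : {set 'I_d.+1 * 'I_d.+1}) (q : 'I_d.+1 * 'I_d.+1).
Hypotheses (Wx : inW d x) (WX : inW d X) (xK : cancel x X) (XK : cancel X x).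
Hypothesis B1 : forall q, q \in B -> (0 < q.1 < q.2)%N.
Hypothesis B2 : forall q q', q \in B -> q' \in B -> q.1 != q'.2.
Hypothesis B3 : forall i k k', (i, k) \in B -> (i, k') \in B -> (k < k')%N -> X k < X k'.
Hypothesis B4 : forall i i' k, (i, k) \in B -> (i', k) \in B -> (i < i')%N -> X i < X i'.

Definition Finv (g : int -> int) := [set q in B | g q.2 < g q.1].

Definition term g F M : R := (v ^+ 2 - 1) ^+ #|M| *
  v ^+ (2 * #|h_set d X F (sigmaK d M)|) * T (g \o sigmaK d M \o x).

Definition all_inversions_in (g : int -> int) :=
  forall a b : 'I_d.+1, (0 < a < b)%N -> g b < g a -> (a, b) \in B.

Lemma set_bij_add (q : 'I_d.+1 * 'I_d.+1) F (P : pred {set 'I_d.+1 * 'I_d.+1})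
    (S : {set 'I_d.+1 * 'I_d.+1} -> R) : q \notin F ->
  \sum_(M | P M && (M \subset q |: F)) S M =
  \sum_(M | P M && (M \subset F)) S M +
  \sum_(M | P (q |: M) && (M \subset F)) S (q |: M).
Proof.
move=> qF; rewrite (bigID (fun M => q \notin M)) /=; congr (_ + _).
  apply: eq_bigl => M; rewrite -andbA; congr (_ && _).
  apply/andP/idP => [[s n]|s].
    apply/subsetP => p pM; have := subsetP s p pM; rewrite !inE => /orP[/eqP E|//].
    by rewrite -E pM in n.
  split; first exact: subset_trans s (subsetUr _ _).
  by apply: contra qF; apply: (subsetP s).
rewrite (reindex_onto (fun M => q |: M) (fun M => M :\ q)) /=; last first.
  by move=> M /andP[_]; rewrite negbK => qM; apply: setD1K.
apply: eq_bigl => M; rewrite setU11 /= andbT -andbA; congr (_ && _).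
rewrite subUset sub1set setU11 /=; apply/andP/idP => [[s /eqP E]|s].
  apply/subsetP => p pM; have := subsetP s p pM; rewrite !inE => /orP[/eqP pq|//].
  by move: pM; rewrite -E pq !inE eqxx.
split; first exact: subset_trans s (subsetUr _ _).
have qM : q \notin M by apply: contra qF; apply: (subsetP s).
by rewrite setU1K.
Qed.

Lemma ord_of (z : int) : 1 <= z <= d%:Z -> exists2 o : 'I_d.+1, z = o & (0 < o)%N.
Proof.
move=> Hz; have lz : (`|z| < d.+1)%N by lia.
by exists (Ordinal lz) => /=; lia.
Qed.

Lemma preserves_ord g (o : 'I_d.+1) : preserves d g -> (0 < o)%N ->
  exists2 o' : 'I_d.+1, g o = o' & (0 < o')%N.
Proof. by move=> P o0; apply/ord_of/P; have := ltn_ord o; lia. Qed.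

Lemma preserves_sref p : (0 < p < d)%N -> preserves d (sref d p).
Proof.
move=> hp i Hi; have [o -> o0] := ord_of i Hi; have := ltn_ord o => od.
by rewrite sref_inner //; iflia.
Qed.

Lemma main_step g h p : inW d g -> inW d h -> cancel g h -> cancel h g ->
  preserves d g -> all_inversions_in g -> (p <= d)%N -> h (p%:Z + 1) < h p%:Z ->
  (preserves d (sref d p \o g) -> all_inversions_in (sref d p \o g) -> (#|Finv (sref d p \o g)| < #|Finv g|)%N ->
    T (sref d p \o g) * T x =
      \sum_(M | admissible d X M && (M \subset Finv (sref d p \o g))) term (sref d p \o g) (Finv (sref d p \o g)) M) ->
  T g * T x = \sum_(M | admissible d X M && (M \subset Finv g)) term g (Finv g) M.
Proof.
move=> Wg Wh gK hK Pg Ig hp lt.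
have Ph := preserves_inv d g h Wg Wh hK Pg.
(* [h] maps [1..d] into itself and fixes 0 and d + 1, so it descends neither at 0 nor at d: the
   letter is interior. *)
have p0 : (0 < p)%N.
  rewrite lt0n; apply/negP => /eqP E; move: lt; rewrite E add0r (inW_0 d h) //.
  by have := Ph 1; move: (h 1) => y; lia.
have pd : (p < d)%N.
  rewrite ltn_neqAle hp andbT; apply/negP => /eqP E; move: lt; rewrite E.
  have -> : d%:Z + 1 = d.+1%:Z by lia.
  by rewrite (inW_mid d h) //; have := Ph d%:Z; move: (h _) => y; lia.
have Ws := sref_inW d p hd hp.
have [op Eop op0] := ord_of p%:Z ltac:(lia).
have [oq Eoq oq0] := ord_of (p%:Z + 1) ltac:(lia).
have [j Ej j0] := preserves_ord h oq Ph oq0.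
have [k Ek k0] := preserves_ord h op Ph op0.
have jk : (j < k)%N by move: lt; rewrite Eoq Eop Ej Ek; lia.
have gj : g j = p%:Z + 1 by rewrite -Ej hK Eoq.
have gk : g k = p%:Z by rewrite -Ek hK Eop.
set g' := sref d p \o g.
have g'v (i : 'I_d.+1) : (0 < i)%N ->
    g' i = if i == j then p%:Z else if i == k then p%:Z + 1 else g i.
  move=> i0; rewrite /g' /=; have [->|ij] := eqVneq i j.
    by rewrite gj (_ : p%:Z + 1 = p.+1%:Z) ?sref_inner; iflia.
  have [->|ik] := eqVneq i k.
    by rewrite gk ?sref_inner; iflia.
  have [o E o0] := preserves_ord g i Pg i0; have od := ltn_ord o.
  have nj : g i <> p%:Z + 1.
    by rewrite -gj => /(inW_inj d g Wg) => -[E']; apply: (negP ij); apply/eqP/val_inj.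
  have nk : g i <> p%:Z.
    by rewrite -gk => /(inW_inj d g Wg) => -[E']; apply: (negP ik); apply/eqP/val_inj.
  by rewrite E in nj nk *; rewrite sref_inner //; iflia.
have g'j : g' j = p%:Z by rewrite g'v // eqxx.
have g'k : g' k = p%:Z + 1.
  by rewrite g'v // eqxx; case: eqP => // E; rewrite E ltnn in jk.
have gne (a i : 'I_d.+1) : a != i -> g a <> g i.
  by move=> /eqP ne /(inW_inj d g Wg) => -[E]; apply/ne/val_inj.
(* p and p + 1 are adjacent values, so exchanging them alters no other comparison. *)
have g'lt (a b : 'I_d.+1) : (0 < a < b)%N -> (a, b) != (j, k) -> (g' b < g' a) = (g b < g a).
  move=> /andP[a0 ab] ne; rewrite !g'v //; last exact: ltn_trans ab.
  have nba : (b == a) = false by apply/eqP => E; rewrite E ltnn in ab.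
  have nab : (a == b) = false by rewrite eq_sym.
  have [bj|bj] := eqVneq b j; have [aj|aj] := eqVneq a j.
  - by rewrite bj aj eqxx in nba.
  - have [ak|ak] := eqVneq a k; first by rewrite bj ak in ab; lia.
    by have := gne _ _ aj; have := gne _ _ ak; rewrite bj gj gk; move: (g a) => u; lia.
  - have [bk|bk] := eqVneq b k; first by rewrite aj bk eqxx in ne.
    by have := gne _ _ bj; have := gne _ _ bk; rewrite aj gj gk; move: (g b) => u; lia.
  have [bk|bk] := eqVneq b k; have [ak|ak] := eqVneq a k.
  - by rewrite bk ak eqxx in nba.
  - by have := gne _ _ aj; have := gne _ _ ak; rewrite bk gj gk; move: (g a) => u; lia.
  - by have := gne _ _ bj; have := gne _ _ bk; rewrite ak gj gk; move: (g b) => u; lia.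
  by [].
have jkB : (j, k) \in B by apply: Ig; rewrite ?j0 ?gj ?gk //; lia.
have Ig' : all_inversions_in g'.
  move=> a b ab; have [[-> ->]//|ne] := eqVneq (a, b) (j, k).
  by rewrite g'lt //; apply: Ig.
have jkF : (j, k) \notin Finv g' by rewrite !inE jkB /= g'j g'k; lia.
have FE : Finv g = (j, k) |: Finv g'.
  apply/setP => q; rewrite !inE; have [->|ne] := eqVneq q (j, k).
    by rewrite jkB /= gj gk; lia.
  case qB : (q \in B) => //=; have := B1 q qB => H.
  by case: q H ne {qB} => a b /= H ne; rewrite -g'lt.
have sF : Finv g' \subset B by apply/subsetP => q; rewrite inE => /andP[].
(* If k' came after k, then (k, k') would be an inversion of [g'] too, hence in [B], and k would be
   a left end there, whereas (j, k) makes it a right end. [C2] is the mirror image. *)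
have C1 (k' : 'I_d.+1) : (j, k') \in Finv g' -> (k' < k)%N.
  rewrite inE /= g'j => /andP[jk'B lt'].
  rewrite ltnNge leq_eqVlt; apply/negP => /orP[/eqP/val_inj E|kk'].
    by rewrite -E g'k in lt'; lia.
  have : (k, k') \in B by apply: Ig'; rewrite ?k0 // g'k; move: (g' _) lt' => u; lia.
  by move=> kB; have /eqP := B2 _ _ kB jkB.
have C2 (j' : 'I_d.+1) : (j', k) \in Finv g' -> (j < j')%N.
  rewrite inE /= g'k => /andP[j'kB lt'].
  rewrite ltnNge leq_eqVlt; apply/negP => /orP[/eqP/val_inj E|kk'].
    by rewrite E g'j in lt'; lia.
  have /andP[j'0 _] := B1 _ j'kB.
  have : (j', j) \in B by apply: Ig'; rewrite ?j'0 // g'j; move: (g' _) lt' => u; lia.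
  by move=> jB; have /eqP := B2 _ _ jkB jB.
have cF : (#|Finv g'| < #|Finv g|)%N by rewrite FE cardsU1 jkF add1n.
have Wg' : inW d g' by apply: inW_comp.
have Wh' : inW d (h \o sref d p) by apply: inW_comp.
have g'K : cancel g' (h \o sref d p) by move=> z; rewrite /g' /= srefK.
have h'K : cancel (h \o sref d p) g' by move=> z; rewrite /g' /= hK srefK.
have h'p : (h \o sref d p) p%:Z = j by rewrite -g'j g'K.
have h'q : (h \o sref d p) (p%:Z + 1) = k by rewrite -g'k g'K.
have TgE : T g = T (sref d p) * T g'.
  rewrite (T_sref_up d R v T hd HH p g' (h \o sref d p)) //; last first.
    by rewrite h'p h'q; lia.
  by apply: T_ext => z; rewrite /g' /= srefK.
have Pg' : preserves d g' by move=> i /Pg; apply: preserves_sref; rewrite p0.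
move=> /(_ Pg' Ig' cF) IH; rewrite TgE -mulrA IH mulr_sumr FE set_bij_add //.
(* Both halves of the split sum are brought to the same index set, with 0 where (j, k) cannot be
   added, so that the two sides can be compared for each [M] separately. *)
have -> : \sum_(M | admissible d X ((j, k) |: M) && (M \subset Finv g'))
     term g ((j, k) |: Finv g') ((j, k) |: M) =
   \sum_(M | admissible d X M && (M \subset Finv g'))
     if admissible d X ((j, k) |: M) then term g ((j, k) |: Finv g') ((j, k) |: M) else 0.
  rewrite -big_mkcondr /=; apply: eq_bigl => M; rewrite andbAC.
  case ok2: (admissible d X ((j, k) |: M)); rewrite ?andbF ?andbT //.
  by rewrite (admissible_sub _ _ _ _ _ ok2).
rewrite -big_split; apply: eq_bigr => M /andP[ok sM] /=.
have mM : matching d M by case/andP: ok.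
have sB := subset_trans sM sF.
have WS := sigmaK_inW d B hd B1 B2 M mM sB.
have SK := sigmaKK d B hd B1 B2 M mM sB.
(* [Y] is the inverse of [y] and takes the values X (sigma j), X (sigma k) at p, p + 1; their order
   decides which multiplication rule applies to T_(s_p) T_y. *)
set y := g' \o sigmaK d M \o x.
set Y := X \o sigmaK d M \o (h \o sref d p).
have Wy : inW d y by do 2 apply: inW_comp => //.
have WY : inW d Y by do 2 apply: inW_comp => //.
have YK : cancel Y y by move=> z; rewrite /Y /y /= XK SK; apply: h'K.
have Yp : Y p%:Z = X (sigmaK d M j) by rewrite -h'p.
have Yq : Y (p%:Z + 1) = X (sigmaK d M k) by rewrite -h'q.
have Tsy : T (sref d p \o y) = T (g \o sigmaK d M \o x).
  by apply: T_ext => z; rewrite /y /g' /= srefK.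
have Cc n a : a * (v ^+ 2 - 1) ^+ n = (v ^+ 2 - 1) ^+ n * a.
  apply: commrX; apply: commrB; last exact: commr1.
  by rewrite /GRing.comm (comm_v d R v T HH).
have Cv := comm_v d R v T HH.
rewrite {1}/term -/y !mulrA Cc -[in LHS](mulrA _ _ (v ^+ _)) Cv -!mulrA.
have [lt'|lt'|] := ltgtP (X (sigmaK d M j)) (X (sigmaK d M k)).
- have [E /negbTE ->] := step_up d X B hd B1 B2 B3 B4 _ j k sF jkB jkF C1 C2 M ok sM lt'.
  rewrite addr0 (T_sref_up d R v T hd HH p y Y) ?Yp ?Yq // Tsy.
  by rewrite /term E -!mulrA.
- have [-> E1 E2] := step_down d X B hd B1 B2 B3 B4 _ j k sF jkB jkF C1 C2 M ok sM lt'.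
  rewrite (T_sref_down d R v T hd HH p y Y) ?Yp ?Yq // Tsy.
  have -> : T y = T (g \o sigmaK d ((j, k) |: M) \o x).
    have okU : matching d ((j, k) |: M).
      by have [/andP[]] := step_down d X B hd B1 B2 B3 B4 _ j k sF jkB jkF C1 C2 M ok sM lt'.
    have sU : (j, k) |: M \subset B by rewrite subUset sub1set jkB.
    have jkM : (j, k) \notin M by apply: contra jkF; apply: (subsetP sM).
    apply: T_ext => z; rewrite /y /= (sigmaK_add d B hd B1 B2) //=.
    have /= -> := trc_conj d g j k Wg (sigmaK d M (x z)).
    rewrite gj gk /g' /= -(trc_swap_root d p hd hp) /root_r /root_l.
    by rewrite (gtn_eqF p0) (ltn_eqF pd).
  rewrite /term E1 E2 cardsU1; have -> : (j, k) \notin M by apply: contra jkF; apply: (subsetP sM).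
  rewrite mulrDr mulrDr add1n [(v ^+ 2 - 1) ^+ _.+1]exprSr; congr (_ + _).
    by rewrite mulnS addnC exprD !mulrA.
  by rewrite -!mulrA; congr (_ * _); rewrite !mulrA; congr (_ * _); rewrite Cv.
by move/(inW_inj d X WX)/(inW_inj d _ WS) => -[E]; move: jk; rewrite E ltnn.
Qed.

Lemma main_sum g : inW d g -> preserves d g -> all_inversions_in g ->
  T g * T x = \sum_(M | admissible d X M && (M \subset Finv g)) term g (Finv g) M.
Proof.
have [n] := ubnP #|Finv g|; elim: n g => // n IH g lt Wg Pg Ig.
have [h [gK hK Wh]] := inWP d g Wg.
have [[p [hp D]]|N] :=
  excluded_middle_informative (exists p, (p <= d)%N /\ h (p%:Z + 1) < h p%:Z).
  apply: (main_step g h p) => // Pg' Ig' cF; apply: IH => //.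
  - exact: leq_trans cF _.
  - by apply: inW_comp => //; apply: sref_inW.
have h1 : h =1 id.
  apply: (increasing_id d) => // p hp; rewrite ltNge le_eqVlt; apply/negP => /orP[/eqP|H].
    by move/(inW_inj d h Wh); lia.
  by apply: N; exists p.
have g1 z : g z = z by rewrite -{1}(h1 z) hK.
have F0 : Finv g = set0.
  apply/setP => q; rewrite !inE !g1; case qB : (q \in B) => //=.
  by have := B1 q qB; lia.
have -> : T g = 1 by case: HH => _ [_ [<- _]]; apply: T_ext.
rewrite mul1r F0 (big_pred1 set0) => [|M]; last first.
  rewrite subset0 andbC /=; case: eqP => // ->; rewrite andTb.
  by apply/andP; split; [apply/matchingP => q q'|apply/forall_inP => q]; rewrite inE.
rewrite /term cards0 expr0 mul1r.
have -> : h_set d X set0 (sigmaK d set0) = set0 by apply/setP => q; rewrite !inE.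
rewrite cards0 expr0 mul1r; apply: T_ext => z /=.
by rewrite g1 /sigmaK enum_set0.
Qed.
End MainSum.

(** * Blocks and tridiagonal matrices *)

Lemma psumS s i : psum s i.+1 = (psum s i + nth 0 s i.+1)%N.
Proof.
rewrite /psum; have [lt|ge] := ltnP i.+1 (size s).
  by rewrite (take_nth 0%N lt) sumn_rcons.
by rewrite !take_oversize ?nth_default ?addn0 // ltnW.
Qed.

Lemma psum0 s : psum s 0 = nth 0%N s 0.
Proof. by case: s => [|a [|b s]] //; rewrite /psum /= addn0. Qed.

Lemma psum_mono s i j : (i <= j)%N -> (psum s i <= psum s j)%N.
Proof.
move=> /subnK <-; elim: (j - i)%N => // n IH.
by rewrite addSn psumS; apply: leq_trans IH (leq_addr _ _).
Qed.

Lemma psum_last r d s : inLambda r d s -> (psum s r + nth 0 s r.+1)%N = d.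
Proof.
by move=> /andP[/eqP sz /eqP <-]; rewrite -psumS /psum take_oversize ?sz.
Qed.

Lemma psum_le r d s i : inLambda r d s -> (i <= r)%N -> (psum s i <= d)%N.
Proof. by move=> H /(psum_mono s) le; have := psum_last r d s H; lia. Qed.

Lemma inR_base r d s (i : nat) (x : int) : (i <= r.+1)%N ->
  inR r d s i x = baseR r d s i x.
Proof.
move=> hi; rewrite /inR divz_small ?modz_small; try lia.
have -> : (i%:Z <= r.+1%:Z) by lia.
by rewrite mul0r subr0 absz_nat.
Qed.

Lemma inR_shift r d s (i t x : int) :
  inR r d s (i + t * (2 * r + 2)%N%:Z) (x + t * DD d) = inR r d s i x.
Proof.
rewrite /inR [i + _]addrC modzMDl divzMDl; last by lia.
have -> : x + t * DD d - (t + (i %/ (2 * r + 2)%N%:Z)%Z) * DD d =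
  x - (i %/ (2 * r + 2)%N%:Z)%Z * DD d by rewrite mulrDl; lia.
by [].
Qed.

Lemma inR_refl r d s (i : nat) (x : int) : (0 < i <= r)%N ->
  inR r d s (2 * r + 2 - i)%N%:Z x = baseR r d s i (DD d - x).
Proof.
move=> hi; rewrite /inR divz_small ?modz_small; try lia.
have -> : ((2 * r + 2 - i)%N%:Z <= r.+1%:Z) = false by lia.
rewrite mul0r subr0 absz_nat; congr baseR; lia.
Qed.

(** The part of R_i inside [1..d]. Block 0 has no lower cut and block r + 1 no upper cut, because
    these two R_i are symmetric about 0 and d + 1. *)
Definition block r d s (i : nat) (y : int) : bool :=
  [&& 0 < y, y <= d%:Z, (i == 0%N) || ((psum s i.-1)%:Z < y) & (i == r.+1) || (y <= (psum s i)%:Z)].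

Lemma block_base r d s i y : inLambda r d s -> (i <= r.+1)%N -> 0 < y <= d%:Z ->
  baseR r d s i y = block r d s i y.
Proof.
move=> Hs hi /andP[y0 yd]; rewrite /baseR /block y0 yd.
have := psum_last r d s Hs; have := psum0 s.
case: i hi => [|i] hi E1 E2 /=; first by rewrite E1; lia.
case: ifP => Hi; first by have -> : (i.+1 == r.+1) = false by lia.
have -> : i = r by lia.
by rewrite eqxx; lia.
Qed.

Lemma block_exists r d s y : inLambda r d s -> 0 < y <= d%:Z ->
  exists2 i, (i <= r.+1)%N & block r d s i y.
Proof.
move=> Hs /andP[y0 yd]; rewrite /block y0 yd /=.
have : exists i, (i == r.+1) || (y <= (psum s i)%:Z) by exists r.+1; rewrite eqxx.
move=> /ex_minnP[i Hi Mi]; exists i; first by apply: Mi; rewrite eqxx.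
rewrite Hi andbT; case: i Mi {Hi} => //= i Mi.
by rewrite ltNge; apply/negP => H; have := Mi i; rewrite H orbT => /(_ isT); rewrite ltnn.
Qed.

Lemma block_le r d s i i' y y' : (i <= r.+1)%N -> (i' <= r.+1)%N ->
  block r d s i y -> block r d s i' y' -> y <= y' -> (i <= i')%N.
Proof.
move=> hi hi' /and4P[_ _ a _] /and4P[_ _ _ b] yy; rewrite leqNgt; apply/negP => lt.
by have := psum_mono s i' i.-1; move: a b; rewrite (_ : (i' == r.+1) = false); lia.
Qed.

Lemma block_uniq r d s i i' y : (i <= r.+1)%N -> (i' <= r.+1)%N ->
  block r d s i y -> block r d s i' y -> i = i'.
Proof.
move=> hi hi' a b; apply: anti_leq; apply/andP; split.
  exact: block_le hi hi' a b (lexx y).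
exact: block_le hi' hi b a (lexx y).
Qed.

(** Prepares a contradiction with tridiagonality should [g] send a point of [1..d] below 0. The
    cases follow the residue of x modulo D: a centre, a point of [1..d], or the mirror image of
    one. *)
Lemma cover_neg r d s x : inLambda r d s -> x < 0 ->
  exists2 i, inR r d s i x & (i < 0) || (i == 0) && (- (psum s 0)%:Z <= x).
Proof.
move=> Hs x0; have [t [y [E Hy]]] := int_reduce d x.
have t0 : t < 0 by move: E; rewrite /DD in Hy *; nia.
set n := (2 * r + 2)%N%:Z.
have tn : t * n <= - n by rewrite /n; nia.
have base (i : nat) : (i <= r.+1)%N -> baseR r d s i y ->
    exists2 i, inR r d s i x & (i < 0) || (i == 0) && (- (psum s 0)%:Z <= x).
  move=> hi H; exists (i%:Z + t * n); last by rewrite /n in tn *; lia.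
  by rewrite E inR_shift inR_base.
have [y0|y0] := eqVneq y 0.
  by apply: (base 0%N) => //; rewrite y0 /baseR /=; lia.
have [y1|y1] := eqVneq y d.+1%:Z.
  apply: (base r.+1) => //; rewrite y1 /baseR /=.
  by rewrite ltnn; lia.
have [y2|y2] := boolP (0 < y <= d%:Z).
  have [i hi bi] := block_exists r d s y Hs y2.
  by apply: (base i hi); rewrite block_base.
have y3 : 0 < DD d - y <= d%:Z by rewrite /DD in Hy *; lia.
have [i hi bi] := block_exists r d s _ Hs y3.
rewrite -(block_base r d s i _ Hs hi y3) in bi.
have [i0|i0] := posnP i.
  exists (0 + (t + 1) * n).
    have -> : x = (y - DD d) + (t + 1) * DD d by rewrite mulrDl mul1r E; lia.
    by rewrite inR_shift inR_base //; move: bi; rewrite i0 /baseR /=; lia.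
  have [t1|t1] := eqVneq t (-1).
    move: bi; rewrite i0 /baseR /= -psum0 => bi.
    by rewrite t1 in E *; rewrite addNr mul0r addr0 eqxx /=; lia.
  by have : (t + 1) * n < 0; [rewrite /n; nia|lia].
have [i1|i1] := eqVneq i r.+1.
  apply: (base r.+1) => //; move: bi; rewrite i1 /baseR /=.
  by rewrite ltnn /DD; lia.
exists ((2 * r + 2 - i)%N%:Z + t * n); last by rewrite /n in tn *; lia.
by rewrite E inR_shift inR_refl //; lia.
Qed.

Lemma cover_big r d s x : inLambda r d s -> d.+1%:Z < x ->
  exists2 i, inR r d s i x &
    (r.+1%:Z < i) || (i == r.+1%:Z) && (x < DD d - (psum s r)%:Z).
Proof.
move=> Hs x0; have [t [y [E Hy]]] := int_reduce d x.
have t0 : 0 <= t by move: E; rewrite /DD in Hy *; nia.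
set n := (2 * r + 2)%N%:Z.
have tn : t = 0 \/ n <= t * n by case: (eqVneq t 0); [left|right; rewrite /n; nia].
have base (i : nat) : t <> 0 -> (i <= r.+1)%N -> baseR r d s i y ->
  exists2 i, inR r d s i x &
    (r.+1%:Z < i) || (i == r.+1%:Z) && (x < DD d - (psum s r)%:Z).
  move=> nt hi H; exists (i%:Z + t * n); last by rewrite /n in tn *; lia.
  by rewrite E inR_shift inR_base.
have [y2|y2] := boolP (y <= d.+1%:Z).
  have nt : t <> 0 by move=> t1; rewrite t1 mul0r in E; lia.
  have [y0|y0] := eqVneq y 0.
    by apply: (base 0%N) => //; rewrite y0 /baseR /=; lia.
  have [y1|y1] := eqVneq y d.+1%:Z.
    apply: (base r.+1) => //; rewrite y1 /baseR /=.
    by rewrite ltnn; lia.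
  have y3 : (0 < y <= d%:Z) by lia.
  have [i hi bi] := block_exists r d s y Hs y3.
  by apply: (base i) => //; rewrite block_base.
have y3 : 0 < DD d - y <= d%:Z by rewrite /DD in Hy *; lia.
have [i hi bi] := block_exists r d s _ Hs y3.
rewrite -(block_base r d s i _ Hs hi y3) in bi.
have [i0|i0] := posnP i.
  exists (0 + (t + 1) * n); last by rewrite mulrDl /n in tn *; lia.
  have -> : x = (y - DD d) + (t + 1) * DD d by rewrite mulrDl mul1r E; lia.
  by rewrite inR_shift inR_base //; move: bi; rewrite i0 /baseR /=; lia.
have [i1|i1] := eqVneq i r.+1.
  exists (r.+1%:Z + t * n).
    rewrite E inR_shift inR_base //; move: bi; rewrite i1 /baseR /=.
    by rewrite ltnn /DD; lia.
  case: tn => [t1|]; last by rewrite /n; lia.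
  rewrite t1 mul0r addr0 eqxx /=; rewrite t1 mul0r addr0 in E.
  have := psum_last r d s Hs; move: bi; rewrite i1 /baseR /=.
  rewrite ltnn.
  by rewrite E /DD; lia.
exists ((2 * r + 2 - i)%N%:Z + t * n); last by case: tn => [->|]; rewrite /n; lia.
by rewrite E inR_shift inR_refl //; lia.
Qed.

Lemma kappa_neq0 r d lam g mu (i : int) (j : nat) (p : int) : (j <= r.+1)%N ->
  0 < p <= d%:Z -> inR r d mu j p -> inR r d lam i (g p) -> kappa r d lam g mu i j <> 0%N.
Proof.
move=> hj hp Hmu Hlam; rewrite /kappa divz_small; last by lia.
move/eqP; rewrite -leqn0 leqNgt -has_count; apply/negP; rewrite negbK; apply/hasP.
exists p; last by rewrite Hmu Hlam.
(* The list in [kappa] starts at -D, so p has position p + D. *)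
apply/mapP; exists (absz (p + DD d)); first by rewrite mem_iota /DD; lia.
by rewrite mul0r add0r /DD; lia.
Qed.

Lemma count_iota_interval (a b n : nat) : (a <= b <= n)%N ->
  count (fun k => a <= k < b)%N (iota 0 n) = (b - a)%N.
Proof.
move=> /andP[ab bn]; have -> : n = (a + ((b - a) + (n - b)))%N by lia.
rewrite !iotaD !count_cat /=.
rewrite (eq_in_count (a2 := pred0)) => [|k]; last by rewrite mem_iota /=; lia.
rewrite (eq_in_count (s := iota _ (b - a)) (a2 := predT)) => [|k]; last by rewrite mem_iota /=; lia.
rewrite (eq_in_count (s := iota _ (n - b)) (a2 := pred0)) => [|k]; last by rewrite mem_iota /=; lia.
by rewrite !count_pred0 count_predT size_iota; lia.
Qed.

Lemma kappa_interval r d lam g mu (i : int) (j : nat) (a b : int) : (j <= r.+1)%N ->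
  - (DD d) <= a -> a <= b -> b < DD d ->
  (forall z, inR r d mu j z && inR r d lam i (g z) = (a < z <= b)) ->
  kappa r d lam g mu i j = absz (b - a).
Proof.
move=> hj ha ab hb E; rewrite /kappa divz_small; last by lia.
rewrite count_map.
(* Positions are shifted by D, and by one more since the interval is open below. *)
rewrite (eq_count (a2 := fun k => (absz (a + DD d + 1)%R <= k < absz (b + DD d + 1)%R)%N)).
  by rewrite count_iota_interval; rewrite /DD in ha hb *; lia.
by move=> k /=; rewrite E mul0r add0r; rewrite /DD in ha hb *; lia.
Qed.

Lemma up_threshold (P : pred int) (a b : int) : a <= b ->
  (forall z z', a < z -> z < z' -> z' <= b -> P z -> P z') ->
  exists2 c, a <= c <= b & forall z, (a < z <= b) && P z = (c < z <= b).
Proof.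
move=> ab up; have [n En] : exists n : nat, b = a + n%:Z by exists (absz (b - a)); lia.
elim: n a ab up En => [|n IH] a ab up En; first by exists a => [|z]; lia.
have [|z z' az zz' z'b||c Hc E] := IH (a + 1); try lia.
  by apply: up => //; lia.
have [Pa|Pa] := boolP (P (a + 1)).
  exists a => [|z]; first by lia.
  case H : (a < z <= b) => //=.
  have [->|ne] := eqVneq z (a + 1); first by [].
  by apply: (up (a + 1)) => //; lia.
exists c => [|z]; first by lia.
rewrite -E; have [->|ne] := eqVneq z (a + 1); last by congr (_ && _); lia.
by rewrite (negbTE Pa) !andbF.
Qed.

Lemma down_threshold (P : pred int) (a b : int) : a <= b ->
  (forall z z', a < z -> z < z' -> z' <= b -> P z' -> P z) ->
  exists2 c, a <= c <= b & forall z, (a < z <= b) && P z = (a < z <= c).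
Proof.
move=> ab down; have [z z' az zz' z'b|c Hc E] := up_threshold (predC P) a b ab.
  by apply: contra; apply: down.
exists c => // z; have := E z; rewrite /=.
by case: (P z); rewrite ?andbT ?andbF /=; lia.
Qed.

Lemma block_range {r d s i y} : block r d s i y -> 0 < y <= d%:Z.
Proof. by case/and4P=> -> ->. Qed.

Lemma block_no_cut r d s j a b : (j <= r.+1)%N -> block r d s j a -> block r d s j b -> a < b ->
  forall i, (i <= r)%N -> ~ (a <= (psum s i)%:Z < b).
Proof.
move=> hj /and4P[_ _ ja _] /and4P[_ _ _ jb] ab i hi H.
have [ij|ij] := ltnP i j; first by have := psum_mono s i j.-1; lia.
by have := psum_mono s j i; move: jb; rewrite (_ : (j == r.+1) = false); lia.
Qed.

Definition block_lo (mu : seq nat) j : int := if j == 0%N then 0 else psum mu j.-1.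

Definition block_hi (r d : nat) (mu : seq nat) j : int := if j == r.+1 then d%:Z else psum mu j.

Lemma blockE r d mu j z : inLambda r d mu -> (j <= r.+1)%N -> block r d mu j z = (block_lo mu j < z <= block_hi r d mu j).
Proof.
move=> Hmu hj; rewrite /block /block_lo /block_hi; have := psum_le r d mu j Hmu.
by case: eqP => [->|?]; case: eqP => ? //=; lia.
Qed.

Lemma block_lo_le_hi r d mu j : inLambda r d mu -> (j <= r.+1)%N -> 0 <= block_lo mu j /\ block_lo mu j <= block_hi r d mu j /\ block_hi r d mu j <= d%:Z.
Proof.
move=> Hmu hj; rewrite /block_lo /block_hi.
have := psum_le r d mu j Hmu; have := psum_le r d mu j.-1 Hmu; have := psum_mono mu j.-1 j (leq_pred _).
by case: eqP => ?; case: eqP => ?; lia.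
Qed.

Lemma inR_pos r d s i z : inLambda r d s -> (0 < i <= r.+1)%N -> inR r d s i z -> 0 < z.
Proof.
move=> Hs hi; rewrite inR_base; last lia; rewrite /baseR.
have := psum_last r d s Hs; rewrite (_ : (i == 0%N) = false); last lia.
by case: ifP; lia.
Qed.

Lemma inR_ltmid r d s i z : inLambda r d s -> (i <= r)%N -> inR r d s i z -> z <= d%:Z.
Proof.
move=> Hs hi; rewrite inR_base; last lia; rewrite /baseR hi.
have := psum_le r d s i Hs hi; have := psum_le r d s 0 Hs isT; rewrite psum0.
by case: ifP; lia.
Qed.

(** * Consequences of tridiagonality *)

Section Tridiagonal.
Variables (r d : nat) (lam mu : seq nat) (g h : int -> int).
Hypotheses (hd : (2 <= d)%N) (Hlam : inLambda r d lam) (Hmu : inLambda r d mu).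
Hypotheses (Wg : inW d g) (Wh : inW d h) (gK : cancel g h) (hK : cancel h g).
Hypotheses (Dg : inDmin r d lam g) (Dh : inDmin r d mu h).
Hypothesis (tri : tridiagonal (kappa r d lam g mu)).
Notation kap := (kappa r d lam g mu).
Notation block_lo := (block_lo mu).
Notation block_hi := (block_hi r d mu).

Lemma mono_h a b : 0 <= a -> a < b -> b <= d.+1%:Z ->
  (forall i, (i <= r)%N -> ~ (a <= (psum lam i)%:Z < b)) -> h a < h b.
Proof.
move=> a0 ab bd N; have [Ea Eb] : a = (absz a)%:Z /\ b = (absz b)%:Z by lia.
rewrite Ea Eb; apply: (inDmin_mono r d lam g) => //; first lia.
by move=> i hi H; apply: (N i hi); lia.
Qed.

Lemma mono_g a b : 0 <= a -> a < b -> b <= d.+1%:Z ->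
  (forall i, (i <= r)%N -> ~ (a <= (psum mu i)%:Z < b)) -> g a < g b.
Proof.
move=> a0 ab bd N; have [Ea Eb] : a = (absz a)%:Z /\ b = (absz b)%:Z by lia.
rewrite Ea Eb; apply: (inDmin_mono r d mu h) => //; first lia.
by move=> i hi H; apply: (N i hi); lia.
Qed.

Lemma tri_index (i : int) (j : nat) p : (j <= r.+1)%N -> 0 < p <= d%:Z ->
  block r d mu j p -> inR r d lam i (g p) -> `|i - j%:Z| <= 1.
Proof.
move=> hj hp bj Hi; rewrite leNgt; apply/negP => /tri; apply: (kappa_neq0 _ _ _ _ _ _ _ p) => //.
by rewrite inR_base // block_base.
Qed.

(** Suppose g p < 0. In block 0 of [mu] this contradicts g 0 = 0, as [g] increases there. In a later
    block tridiagonality leaves only R_0 for g p; then -(g p) lies in block 0 of [lam], where [h]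
    increases from h 0 = 0, yet h (- g p) = -p. *)
Lemma g_pos p : 0 < p <= d%:Z -> 0 < g p.
Proof.
move=> hp; have [j hj bj] := block_exists r d mu p Hmu hp.
rewrite ltNge le_eqVlt; apply/negP => /orP[/eqP gp0|gp].
  have : p = 0 by rewrite -(gK p) gp0 (inW_0 d h).
  by lia.
have [j0|j0] := posnP j.
  have : g 0 < g p.
    apply: mono_g; try lia; move=> i hi H.
    have := psum_mono mu 0 i (leq0n _); move: bj; rewrite j0 /block /=; lia.
  by rewrite (inW_0 d g) //; move: gp; move: (g p) => u; lia.
have [i Hi Ci] := cover_neg r d lam (g p) Hlam gp.
have := tri_index i j p hj hp bj Hi.
have [[i0 Hle]|i0] : (i = 0 /\ - (psum lam 0)%:Z <= g p) \/ i < 0 by move: Ci; lia.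
  have : h 0 < h (- g p).
    apply: mono_h; try lia.
      by have := psum_le r d lam 0 Hlam isT; lia.
    by move=> i' hi' H; have := psum_mono lam 0 i' (leq0n _); lia.
  by rewrite (inW_N d h) // gK (inW_0 d h) //; lia.
by lia.
Qed.

Lemma g_lt p : 0 < p <= d%:Z -> g p < d.+1%:Z.
Proof.
move=> hp; have [j hj bj] := block_exists r d mu p Hmu hp.
rewrite ltNge le_eqVlt; apply/negP => /orP[/eqP gp0|gp].
  have : p = d.+1%:Z by rewrite -(gK p) -gp0 (inW_mid d h).
  by lia.
have [j0|j0] := eqVneq j r.+1.
  have : g p < g d.+1%:Z.
    apply: mono_g; try lia; move=> i hi H.
    by have := psum_mono mu i r hi; move: bj; rewrite j0 /block /=; lia.
  by rewrite (inW_mid d g) //; move: gp; move: (g p) => u; lia.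
have [i Hi Ci] := cover_big r d lam (g p) Hlam gp.
have T := tri_index i j p hj hp bj Hi.
have [[i0 Hle]|i0] : (i = r.+1%:Z /\ g p < DD d - (psum lam r)%:Z) \/ r.+1%:Z < i.
- by move: Ci; lia.
- have : h (DD d - g p) < h d.+1%:Z.
    apply: mono_h; try by rewrite /DD in Hle *; lia.
    by move=> i' hi' H; have := psum_mono lam i' r hi'; lia.
  by rewrite (inW_refl d h) // gK (inW_mid d h) // /DD; lia.
by lia.
Qed.

Lemma g_preserves : preserves d g.
Proof. by move=> p Hp; have := g_pos p; have := g_lt p; move: (g p) => u; lia. Qed.

Lemma g_block p : 0 < p <= d%:Z -> exists2 i, (i <= r.+1)%N & block r d lam i (g p).
Proof. by move=> hp; apply: block_exists => //; apply: g_preserves; lia. Qed.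

Lemma tri_block i j p : (i <= r.+1)%N -> (j <= r.+1)%N -> block r d mu j p -> block r d lam i (g p) ->
  (i <= j.+1)%N /\ (j <= i.+1)%N.
Proof.
move=> hi hj bj bi; have := tri_index i j p hj (block_range bj) bj.
by rewrite inR_base // block_base //; [move/(_ bi); lia|apply: block_range bi].
Qed.

Lemma g_incr j a b : (j <= r.+1)%N -> block r d mu j a -> block r d mu j b -> a < b -> g a < g b.
Proof.
move=> hj ba bb ab; have := block_range ba; have := block_range bb => ??.
by apply: mono_g; try lia; apply: (block_no_cut r d mu j).
Qed.

Lemma h_incr j a b : (j <= r.+1)%N -> block r d lam j a -> block r d lam j b -> a < b -> h a < h b.
Proof.
move=> hj ba bb ab; have := block_range ba; have := block_range bb => ??.
by apply: mono_h; try lia; apply: (block_no_cut r d lam j).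
Qed.

(** Let j, j' be the [mu]-blocks of a, b and i, i' the [lam]-blocks of their images. Monotonicity
    inside blocks gives j < j' and i' < i, and the chain i <= j + 1 <= j' <= i' + 1 <= i collapses
    to equalities. *)
Lemma inversion_blocks a b : 0 < a -> a < b -> b <= d%:Z -> g b < g a ->
  exists2 i, (i <= r)%N & [/\ block r d mu i a, block r d lam i.+1 (g a),
                              block r d mu i.+1 b & block r d lam i (g b)].
Proof.
move=> a0 ab bd inv; have ha : 0 < a <= d%:Z by lia.
have hb : 0 < b <= d%:Z by lia.
have [j hj bj] := block_exists r d mu a Hmu ha.
have [j' hj' bj'] := block_exists r d mu b Hmu hb.
have [i hi bi] := g_block a ha.
have [i' hi' bi'] := g_block b hb.
have jj := block_le r d mu j j' a b hj hj' bj bj' (ltW ab).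
have ii := block_le r d lam i' i _ _ hi' hi bi' bi (ltW inv).
have nj : j <> j'.
  move=> E; rewrite -E in bj'; have := g_incr j a b hj bj bj' ab.
  by move: (g a) (g b) inv => u v; lia.
have ni : i <> i'.
  move=> E; rewrite -E in bi'; have := h_incr i _ _ hi bi' bi inv.
  by rewrite !gK; lia.
have T := tri_block i j a hi hj bj bi; have T' := tri_block i' j' b hi' hj' bj' bi'.
have Ei : i = i'.+1 by lia.
have Ej : j = i' by lia.
have Ej' : j' = i'.+1 by lia.
by subst i j j'; exists i'; [lia|split].
Qed.

(** Points outside [1..d] count only at the corners (0, 0) and (r + 1, r + 1), which the last two
    conditions exclude: elsewhere [g] keeps such a point on its own side, away from R_i. *)
Lemma inR_block i j z : (i <= r.+1)%N -> (j <= r.+1)%N -> (0 < i)%N || (j != 0%N) -> (i <= r)%N || (j != r.+1) ->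
  inR r d mu j z && inR r d lam i (g z) = (block_lo j < z <= block_hi j) && block r d lam i (g z).
Proof.
move=> hi hj c1 c2; rewrite -blockE //.
have [Hz|Hz] := boolP (0 < z <= d%:Z).
  by rewrite !inR_base // !block_base //; have := g_preserves z; move: (g z) => u; lia.
have -> : block r d mu j z = false by apply/negP => /block_range; rewrite (negbTE Hz).
rewrite andFb; apply/negP => /andP[Rj Ri].
have gneg : z <= 0 -> 0 < g z -> - (d%:Z) <= z -> False.
  move=> z0 gz dz; have [z0'|z0'] := eqVneq z 0; first by move: gz; rewrite z0' (inW_0 d g).
  by have := g_preserves (- z); rewrite (inW_N d g) //; move: (g z) gz => u; lia.
have gbig : d%:Z < z -> g z <= d%:Z -> z <= DD d - 1 -> False.
  move=> z0 gz dz; have [z0'|z0'] := eqVneq z d.+1%:Z.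
    by move: gz; rewrite z0' (inW_mid d g) //; lia.
  by have := g_preserves (DD d - z); rewrite (inW_refl d g) // /DD in dz *; move: (g z) gz => u; lia.
have [j0|j0] := posnP j.
  apply: gneg.
  - by have := inR_ltmid r d mu j z Hmu; rewrite Rj; lia.
  - by apply: (inR_pos r d lam i) => //; lia.
  move: Rj; rewrite j0 inR_base // /baseR /=.
  by have := psum_le r d mu 0 Hmu isT; rewrite psum0; lia.
have jp := inR_pos r d mu j z Hmu _ Rj.
have [j1|j1] := eqVneq j r.+1; last by have := inR_ltmid r d mu j z Hmu _ Rj; lia.
apply: gbig; first lia.
  by apply: (inR_ltmid r d lam i) => //; lia.
move: Rj; rewrite j1 inR_base // /baseR /= ltnn.
by have := psum_last r d mu Hmu; rewrite /DD; lia.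
Qed.

(** [g] increases on block j and cannot reach beyond block j + 1, so the points it carries up form a
    final segment, whose size is the entry of [kappa]. Dually, [kap_down] yields an initial
    segment. *)
Lemma kap_up j : (j <= r)%N -> (kap j.+1 j)%:Z <= block_hi j - block_lo j /\
  forall z, block r d mu j z && block r d lam j.+1 (g z) = (block_hi j - (kap j.+1 j)%:Z < z <= block_hi j).
Proof.
move=> hj; have [lo0 [lohi hid]] := block_lo_le_hi r d mu j Hmu (leqW hj).
have [|z z' az zz' z'b|c Hc E] := up_threshold (fun z => block r d lam j.+1 (g z)) (block_lo j) (block_hi j).
- by [].
- have bz : block r d mu j z by rewrite blockE; lia.
  have bz' : block r d mu j z' by rewrite blockE; lia.
  move=> bi; have [i' hi' bi'] := g_block z' ltac:(lia).
  have lt := g_incr j z z' (leqW hj) bz bz' zz'.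
  have := block_le r d lam j.+1 i' _ _ ltac:(lia) hi' bi bi' (ltW lt).
  have := tri_block i' j z' hi' (leqW hj) bz' bi' => T ?.
  by have <- : i' = j.+1 by lia.
have K : kap j.+1 j = absz (block_hi j - c).
  apply: kappa_interval; try (rewrite /DD; lia).
  by move=> z; rewrite inR_block ?E //; lia.
split; first by rewrite K; lia.
by move=> z; rewrite blockE ?leqW // E K; lia.
Qed.

Lemma kap_down j : (j <= r)%N -> (kap j j.+1)%:Z <= block_hi j.+1 - block_lo j.+1 /\
  forall z, block r d mu j.+1 z && block r d lam j (g z) = (block_lo j.+1 < z <= block_lo j.+1 + (kap j j.+1)%:Z).
Proof.
move=> hj; have [lo0 [lohi hid]] := block_lo_le_hi r d mu j.+1 Hmu hj.
have [|z z' az zz' z'b|c Hc E] := down_threshold (fun z => block r d lam j (g z)) (block_lo j.+1) (block_hi j.+1).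
- by [].
- have bz : block r d mu j.+1 z by rewrite blockE; lia.
  have bz' : block r d mu j.+1 z' by rewrite blockE; lia.
  move=> bi; have [i' hi' bi'] := g_block z ltac:(lia).
  have lt := g_incr j.+1 z z' hj bz bz' zz'.
  have := block_le r d lam i' j _ _ hi' (leqW hj) bi' bi (ltW lt).
  have := tri_block i' j.+1 z hi' hj bz bi' => T ?.
  by have <- : i' = j by lia.
have K : kap j j.+1 = absz (c - block_lo j.+1).
  apply: kappa_interval; try (rewrite /DD; lia).
  by move=> z; rewrite inR_block ?E //; lia.
split; first by rewrite K; lia.
by move=> z; rewrite blockE // E K; lia.
Qed.
End Tridiagonal.

(** * The composition delta and its blocks *)

Section DeltaBlocks.
Variables (r d : nat) (lam mu : seq nat) (g h : int -> int).
Hypotheses (hd : (2 <= d)%N) (Hlam : inLambda r d lam) (Hmu : inLambda r d mu).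
Hypotheses (Wg : inW d g) (Wh : inW d h) (gK : cancel g h) (hK : cancel h g).
Hypotheses (Dg : inDmin r d lam g) (Dh : inDmin r d mu h).
Hypothesis (tri : tridiagonal (kappa r d lam g mu)).
Notation kap := (kappa r d lam g mu).
Notation block_lo := (block_lo mu).
Notation block_hi := (block_hi r d mu).

Let gblk := g_block r d lam mu g h hd Hlam Hmu Wg Wh gK hK Dg Dh tri.
Let triblk := tri_block r d lam mu g hd Hlam Hmu tri.
Let up := kap_up r d lam mu g h hd Hlam Hmu Wg Wh gK hK Dg Dh tri.
Let down := kap_down r d lam mu g h hd Hlam Hmu Wg Wh gK hK Dg Dh tri.
Let pres := g_preserves r d lam mu g h hd Hlam Hmu Wg Wh gK hK Dg Dh tri.
Let RB := inR_block r d lam mu g h hd Hlam Hmu Wg Wh gK hK Dg Dh tri.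
Let BE j z := blockE r d mu j z Hmu.

(** The initial segment that goes down and the final one that goes up cannot overlap, and by
    tridiagonality whatever lies between them stays in its block. *)
Lemma kap_mid j : (j < r)%N ->
  (kap j.+1 j.+1)%:Z = block_hi j.+1 - (kap j.+2 j.+1)%:Z - (block_lo j.+1 + (kap j j.+1)%:Z).
Proof.
move=> hj; have [l0 [lohi hid]] := block_lo_le_hi r d mu j.+1 Hmu (leqW hj).
have [u1 U] := up j.+1 hj; have [d1 D] := down j (ltnW hj).
set a := block_lo j.+1 + _; set b := block_hi j.+1 - _.
have ab : a <= b.
  rewrite leNgt; apply/negP => lt.
  have Da := D a; have Ua := U a.
  have /andP[_ D'] : block r d mu j.+1 a && block r d lam j (g a) by rewrite Da /a; rewrite /a /b in lt; lia.
  have /andP[_ U'] : block r d mu j.+1 a && block r d lam j.+2 (g a) by rewrite Ua /a; rewrite /a /b in lt; lia.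
  by have := block_uniq r d lam j j.+2 (g a) ltac:(lia) ltac:(lia) D' U'; lia.
rewrite (kappa_interval r d lam g mu j.+1 j.+1 a b) //; try (rewrite /a /b /DD; lia).
move=> z; rewrite RB //; try lia.
have [Hz|Hz] := boolP (block_lo j.+1 < z <= block_hi j.+1); last by rewrite /a /b; lia.
have bz : block r d mu j.+1 z by rewrite BE //; lia.
have := D z; have := U z; rewrite bz /= => Uz Dz.
have [i hi bi] := gblk z ltac:(lia).
have T := triblk i j.+1 z hi (leqW hj) bz bi.
have F i' : (i' <= r.+1)%N -> block r d lam i' (g z) = (i' == i).
  move=> hi'; apply/idP/eqP => [bi'|-> //]; exact: (block_uniq r d lam i' i (g z)).
move: Uz Dz; rewrite !F ?ltnS //; try lia.
Qed.

(** The set counted is symmetric about 0 and contains 0, which is the origin of the entry (b_00 -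
    1)/2 of [delta]: it counts the positive points of R_0 that stay in R_0. *)
Lemma kap_corner : (kap 0%N 0%N)%:Z = 2 * ((psum mu 0)%:Z - (kap 1%N 0%N)%:Z) + 1.
Proof.
have [l0 [lohi hid]] := block_lo_le_hi r d mu 0 Hmu isT.
have [u1 U] := up 0 isT.
have bh : block_hi 0%N = psum mu 0 by [].
have bl : block_lo 0%N = 0 by [].
set m := (psum mu 0)%:Z - _.
rewrite bh bl subr0 in u1 *.
have m0 : 0 <= m by rewrite subr_ge0.
have base s z : inR r d s 0 z = (- (psum s 0)%:Z <= z <= (psum s 0)%:Z).
  by rewrite (inR_base r d s 0) // /baseR /= psum0.
have pos z : 0 < z -> inR r d mu 0 z && inR r d lam 0 (g z) = (z <= m).
  move=> z0; have [Hz|Hz] := boolP (z <= (psum mu 0)%:Z); last first.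
    by rewrite base /m; lia.
  have bz : block r d mu 0 z by rewrite BE // bh bl; lia.
  have gz := pres z ltac:(lia).
  rewrite !(inR_base r d _ 0) // !block_base //; try lia; rewrite bz /=.
  have := U z; rewrite bz /= bh.
  have [i hi bi] := gblk z ltac:(lia).
  have T := triblk i 0 z hi isT bz bi.
  have F i' : (i' <= r.+1)%N -> block r d lam i' (g z) = (i' == i).
    move=> hi'; apply/idP/eqP => [bi'|-> //]; exact: (block_uniq r d lam i' i (g z)).
  by rewrite !F // /m; lia.
rewrite (kappa_interval r d lam g mu 0%N 0%N (- m - 1) m) //; try (rewrite /DD; lia).
move=> z; have [z0|z0|->] := ltgtP z 0.
- have := pos (- z) ltac:(lia); rewrite (inW_N d g) // !base.
  by move: (g z) => u; lia.
- by rewrite pos //; lia.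
by rewrite (inW_0 d g) // !base; lia.
Qed.

Notation delta := (delta_seq r kap).

Lemma delta_nth0 : nth 0%N delta 0 = ((kap 0%N 0%N).-1 %/ 2)%N.
Proof. by rewrite nth_mkseq //; lia. Qed.

Lemma delta_nth1 j : (j <= r)%N -> nth 0%N delta (3 * j + 1) = kap j.+1 j.
Proof.
move=> hj; rewrite nth_mkseq; last lia.
have -> : ((3 * j + 1 + 1) %/ 3)%N = j by lia.
have -> : ((3 * j + 1 + 1) %% 3)%N = 2%N by lia.
by rewrite /=; congr kappa; lia.
Qed.

Lemma delta_nth2 j : (j <= r)%N -> nth 0%N delta (3 * j + 2) = kap j j.+1.
Proof.
move=> hj; rewrite nth_mkseq; last lia.
have -> : ((3 * j + 2 + 1) %/ 3)%N = j.+1 by lia.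
have -> : ((3 * j + 2 + 1) %% 3)%N = 0%N by lia.
by rewrite /=; congr kappa; lia.
Qed.

Lemma delta_nth3 j : (j < r)%N -> nth 0%N delta (3 * j + 3) = kap j.+1 j.+1.
Proof.
move=> hj; rewrite nth_mkseq; last lia.
have -> : ((3 * j + 3 + 1) %/ 3)%N = j.+1 by lia.
have -> : ((3 * j + 3 + 1) %% 3)%N = 1%N by lia.
by rewrite /= (_ : (j.+1 == r.+1) = false) //; lia.
Qed.

(** The cuts of [delta] are those of [mu], at the positions 3j + 1, together with the start of the
    upward segment before each and the end of the downward segment after it. *)
Lemma delta_psum j : (j <= r)%N ->
  [/\ (psum delta (3 * j))%:Z = (psum mu j)%:Z - (kap j.+1 j)%:Z,
      psum delta (3 * j + 1) = psum mu j &
      psum delta (3 * j + 2) = (psum mu j + kap j j.+1)%N].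
Proof.
elim: j => [_|j IH hj].
  have [l0 [lohi hid]] := block_lo_le_hi r d mu 0 Hmu isT.
  have [u1 _] := up 0 isT; have K := kap_corner.
  have E0 : (psum delta 0)%:Z = (psum mu 0)%:Z - (kap 1%N 0%N)%:Z.
    by rewrite psum0 delta_nth0; move: u1; rewrite /block_hi /block_lo /=; lia.
  have E1 : psum delta 1 = psum mu 0.
    by rewrite psumS (delta_nth1 0) //; lia.
  rewrite muln0 !add0n; split=> //.
  by have := delta_nth2 0 isT; rewrite muln0 add0n => N; rewrite psumS N E1.
have [_ _ E2] := IH (ltnW hj).
have K := kap_mid j hj; have [u1 _] := up j.+1 hj.
have bh : block_hi j.+1 = psum mu j.+1 by rewrite /block_hi (_ : (j.+1 == r.+1) = false) //; lia.
have bl : block_lo j.+1 = psum mu j by [].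
have idx : (3 * j.+1 = (3 * j + 2).+1)%N by lia.
have E3 : (psum delta (3 * j.+1))%:Z = (psum mu j.+1)%:Z - (kap j.+2 j.+1)%:Z.
  have -> : psum delta (3 * j.+1) = (psum mu j + kap j j.+1 + kap j.+1 j.+1)%N.
    by rewrite idx psumS E2 -addnS delta_nth3.
  by rewrite bh bl in K; lia.
have E4 : psum delta (3 * j.+1 + 1) = psum mu j.+1.
  rewrite addn1 psumS -[X in nth _ _ X]addn1 delta_nth1 //.
  by move: (kap _ _) E3 => m; lia.
split=> //; rewrite addn2 psumS -[X in psum _ X]addn1 E4.
by rewrite -[X in nth _ _ X]addn2 delta_nth2.
Qed.

(** By [kap_up] and [kap_down], R_(3i-2) and R_(3i-1) are the two segments adjoining a cut of [mu],
    the one moving up and the other down. The index here starts at 0, one less than in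
    [blockpair]. *)
Lemma blockpairP (a b : int) :
  reflect (exists2 i, (i <= r)%N & [/\ block r d mu i a, block r d lam i.+1 (g a),
                                      block r d mu i.+1 b & block r d lam i (g b)])
    (blockpair r d delta a b).
Proof.
have inJ i z : (i <= r)%N -> inR (3 * r + 2) d delta (3 * i.+1%:Z - 2) z =
    block r d mu i z && block r d lam i.+1 (g z).
  move=> hi; have [_ ->] := up i hi; have [E0 E1 _] := delta_psum i hi.
  have -> : 3 * i.+1%:Z - 2 = (3 * i + 1)%N%:Z by lia.
  rewrite inR_base; last lia; rewrite /baseR.
  have -> : (3 * i + 1 == 0)%N = false by lia.
  have -> : (3 * i + 1 <= 3 * r + 2)%N by lia.
  rewrite E1 addn1 E0 /block_hi; have -> : (i == r.+1) = false by lia.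
  by [].
have inK i z : (i <= r)%N -> inR (3 * r + 2) d delta (3 * i.+1%:Z - 1) z =
    block r d mu i.+1 z && block r d lam i (g z).
  move=> hi; have [_ ->] := down i hi; have [E0 E1 E2] := delta_psum i hi.
  have -> : 3 * i.+1%:Z - 1 = (3 * i + 2)%N%:Z by lia.
  rewrite inR_base; last lia; rewrite /baseR.
  have -> : (3 * i + 2 == 0)%N = false by lia.
  have -> : (3 * i + 2 <= 3 * r + 2)%N by lia.
  have -> : (3 * i + 2).-1 = (3 * i + 1)%N by lia.
  by rewrite E1 E2 /block_lo /= PoszD.
apply: (iffP existsP) => [[[[|i] hi] //]|[i hi [ha ga hb gb]]].
  move=> /andP[/andP[_ Ha] Hb]; exists i => //.
  have /andP[-> ->] := etrans (esym (inJ i a hi)) Ha.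
  by have /andP[-> ->] := etrans (esym (inK i b hi)) Hb.
have hi' : (i.+1 < r.+2)%N by [].
exists (Ordinal hi'); apply/andP; split; [apply/andP; split=> //|].
  by apply: (etrans (inJ i a hi)); rewrite ha ga.
by apply: (etrans (inK i b hi)); rewrite hb gb.
Qed.

Lemma blockpair_delta a b : blockpair r d delta a b -> exists2 i, (i <= r)%N &
  [/\ block r d mu i a, block r d mu i.+1 b, (psum delta (3 * i))%:Z < a <= (psum delta (3 * i + 1))%:Z &
      (psum delta (3 * i + 1))%:Z < b <= (psum delta (3 * i + 2))%:Z].
Proof.
move=> /blockpairP[i hi [ha ga hb gb]]; exists i => //.
have [_ U] := up i hi; have [_ D] := down i hi; have [E0 E1 E2] := delta_psum i hi.
have := U a; have := D b; rewrite ha ga hb gb /= E0 E1 E2.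
rewrite /block_lo /block_hi /= (_ : (i == r.+1) = false); last lia.
by split=> //; lia.
Qed.
End DeltaBlocks.

(** * Application to the given double coset representative *)

Lemma finvE (f h : int -> int) : cancel f h -> cancel h f -> Defs.finv f =1 h.
Proof.
move=> fK hK y; apply: (can_inj fK); rewrite hK /Defs.finv.
by apply: (@epsilon_spec int (inhabits 0) (fun x => f x = y)); exists (h y).
Qed.

Lemma psum_notin r' d s t a b (p : nat) : (t < r'.+1)%N -> (p <= d)%N ->
  (psum s t)%:Z < a -> a <= p%:Z < b -> b <= (psum s t.+1)%:Z -> par_ok r' d s p.
Proof.
move=> ht hp ta ap bt; apply: par_okP => // i hi E.
have [it|it] := leqP i t; first by have := psum_mono s i t it; lia.
by have := psum_mono s t.+1 i it; lia.
Qed.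

(** Summing over [M] amounts to summing over sigma: a pair (j, k) of the allowed blocks belongs to
    [M] exactly when sigma sends j to k, so [M] can be read off from [sigmaK d M]. *)
Theorem theoremA (r d : nat) (hd : (2 <= d)%N)
  (R : nzRingType) (v : R) (T : (int -> int) -> R)
  (HH : hecke_rel d R v T)
  (lam mu nu : seq nat)
  (Hlam : inLambda r d lam) (Hmu : inLambda r d mu) (Hnu : inLambda r d nu)
  (g1 : int -> int) (Hg1 : inDmin2 r d lam mu g1)
  (Htri : tridiagonal (kappa r d lam g1 mu)) :
  let delta := delta_seq r (kappa r d lam g1 mu) in
  forall (g2 w : int -> int),
    inDmin2 r d mu nu g2 ->
    inDmin (3 * r + 2) d delta w -> inWpar r d mu w ->
    T g1 * T (w \o g2) =
    \sum_(M : {set ('I_d.+1 * 'I_d.+1)%type} | validK r d delta (w \o g2) M)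
       ((v ^+ 2 - 1) ^+ #|M| * v ^+ (2 * hcount r d delta (w \o g2) (sigmaK d M))
        * T (g1 \o sigmaK d M \o w \o g2)).
Proof.
move=> delta g2 w [Dg2 _] Dw Pw.
have [Dg1 [h1 [Wh1 [gK [hK Dh1]]]]] := Hg1.
have [Wg1 _] := Dg1; have [Wg2 _] := Dg2; have [Ww _] := Dw.
have Wx : inW d (w \o g2) by apply: inW_comp.
have [X [xK XK WX]] := inWP d _ Wx.
have EX : Defs.finv (w \o g2) = X by apply: functional_extensionality; apply: finvE.
have BP a b := blockpairP r d lam mu g1 h1 hd Hlam Hmu Wg1 Wh1 gK hK Dg1 Dh1 Htri a b.
have BD a b := blockpair_delta r d lam mu g1 h1 hd Hlam Hmu Wg1 Wh1 gK hK Dg1 Dh1 Htri a b.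
pose B := [set q : 'I_d.+1 * 'I_d.+1 | blockpair r d delta q.1 q.2].
have uniq_mu i i' y : (i <= r.+1)%N -> (i' <= r.+1)%N -> block r d mu i y -> block r d mu i' y -> i = i'.
  exact: block_uniq.
(* Ascent of [X] needs p to avoid the cuts of [mu], for [g2], and those of [delta], for w; hence
   both points are taken in one block of each. *)
have Xincr t i (y z : 'I_d.+1) : (t < (3 * r + 2).+1)%N -> (i <= r.+1)%N ->
    block r d mu i y -> block r d mu i z ->
    (psum delta t)%:Z < y -> z%:Z <= (psum delta t.+1)%:Z -> (y < z)%N -> X y < X z.
  move=> ht hi by_ bz ty tz yz; apply: step_mono => // p Hp.
  have hp : (p <= d)%N by have := ltn_ord z; lia.
  apply: (inDmin_comp_step r d mu (3 * r + 2) delta w g2) => //.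
    apply: par_okP => // i' hi' E.
    by apply: (block_no_cut r d mu i y z hi by_ bz _ i' hi'); rewrite ?E; lia.
  by apply: (psum_notin _ _ _ t y z) => //; lia.
have B1 q : q \in B -> (0 < q.1 < q.2)%N.
  rewrite inE => /BD[i hi [/block_range/andP[q0 _] _ /andP[_ u] /andP[u' _]]].
  by have := le_lt_trans u u'; rewrite !ltz_nat in q0 * => ->; rewrite q0.
(* A common end would lie in [mu]-block i = i' + 1 while its image lies in [lam]-block i + 1 =
   i'. *)
have B2 q q' : q \in B -> q' \in B -> q.1 != q'.2.
  rewrite !inE => /BP[i hi [b1 b2 _ _]] /BP[i' hi' [_ _ b3 b4]].
  apply/eqP => E; rewrite -E in b3 b4.
  have := block_uniq _ _ _ _ _ _ (leqW hi) (hi' : (i'.+1 <= r.+1)%N) b1 b3.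
  have := block_uniq _ _ _ _ _ _ (hi : (i.+1 <= r.+1)%N) (leqW hi') b2 b4.
  by lia.
have B3 (i k k' : 'I_d.+1) : (i, k) \in B -> (i, k') \in B -> (k < k')%N -> X k < X k'.
  rewrite !inE => /BD[a ha [b1 b2 _ H1]] /BD[a' ha' [b1' b2' _ H2]].
  have E := block_uniq _ _ _ _ _ _ (leqW ha) (leqW ha') b1 b1'; subst a'.
  case/andP: H1 => l1 _; case/andP: H2 => _; rewrite (addnS _ 1) => u2 kk'.
  by apply: (Xincr (3 * a + 1)%N a.+1 k k') => //; lia.
have B4 (i i' k : 'I_d.+1) : (i, k) \in B -> (i', k) \in B -> (i < i')%N -> X i < X i'.
  rewrite !inE => /BD[a ha [b1 b2 H1 _]] /BD[a' ha' [b1' b2' H2 _]].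
  have [E] := block_uniq _ _ _ _ _ _ (ha : (a.+1 <= r.+1)%N) (ha' : (a'.+1 <= r.+1)%N) b2 b2'; subst a'.
  case/andP: H1 => l1 _; case/andP: H2 => _; rewrite addn1 => u2 ii'.
  by apply: (Xincr (3 * a)%N a i i') => //; lia.
have Pg1 := g_preserves r d lam mu g1 h1 hd Hlam Hmu Wg1 Wh1 gK hK Dg1 Dh1 Htri.
have Ig1 : all_inversions_in d B g1.
  move=> a b /andP[a0 ab] lt; rewrite inE; apply/BP.
  by apply: (inversion_blocks r d lam mu g1 h1) => //; rewrite lez_nat -ltnS ltn_ord.
(* Conversely, each pair of [B] is an inversion: the images lie in blocks i + 1 and i of [lam], in
   that order. *)
have FB : Finv d B g1 = B.
  apply/setP => q; rewrite !inE; case bp : (blockpair _ _ _ _ _) => //=.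
  have [i hi [_ b2 _ b4]] := BP _ _ bp.
  move: b2 b4; rewrite /block /=.
  by move: (g1 _) (g1 _) => y z; rewrite (_ : (i == r.+1) = false); lia.
rewrite (main_sum d R v T hd HH (w \o g2) X B) // FB.
apply: eq_big => [M|M _]; last first.
  rewrite /term /hcount /h_set EX; congr (_ * v ^+ (2 * _) * _).
  by apply: eq_card => q; rewrite !inE -andbA.
rewrite /validK EX /admissible /matching -andbA [in RHS]andbC.
congr (_ && _).
apply/idP/forall_inP => [/andP[/forall_inP lM /subsetP sM] q qM|H].
  by have := sM q qM; rewrite inE /= => ->; rewrite lM.
apply/andP; split; first by apply/forall_inP => q /H /andP[].
by apply/subsetP => q /H /andP[bp _]; rewrite inE.
Qed.
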